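(* Suppose the standing assumptions (A1)–(A6) hold, that the primal-dual variational coherence condition holds (i.e. $\mathbb{S}_{\mathrm{MVIS}}\neq\emptyset$), and that the parameters satisfy $\frac{\sqrt5-1}{2}\le\eta<1$, $0<\gamma<\frac1\tau$ and $0<\alpha\le\frac{1}{2(\gamma\tau^2+L+\tau)\eta}$. Let $\{(v^k,u^k,p^k)\}$ be generated by ALAVI and let $w^k=(v^k,u^k,p^k)$. Then $$\liminf_{k\to\infty}\sqrt k\,\|w^{k-1}-w^k\|=0 ,$$ and likewise $\liminf_{k\to\infty}\sqrt k\,\operatorname{dist}(0,H(u^k,p^k))=0$ (i.e. an asymptotic $o(1/\sqrt k)$ rate, in this sense, for $\|w^{k-1}-w^k\|$ and for $\operatorname{dist}(0,H(u^k,p^k))$).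
   Context: Setting. $G:\mathbb R^n\to\mathbb R^n$ is continuous; $\mathbf U\subseteq\mathbb R^n$ is a closed convex set; $J$ is a function that is finite and continuous on $\mathbf U$; $\Theta:\mathbb R^n\to\mathbb R^m$ is continuous; $\mathbf C\subseteq\mathbb R^m$ is a nonempty closed convex cone with dual cone $\mathbf C^*=\{q\in\mathbb R^m:\langle q,\theta\rangle\ge0\ \forall\theta\in\mathbf C\}$; $\Pi$ is the Euclidean projection onto $\mathbf C^*$. Let $\Gamma=\{u\in\mathbf U:\Theta(u)\in-\mathbf C\}$. Problem (VIP): find $u^*\in\Gamma$ with $\langle G(u^* ),u-u^*\rangle+J(u)-J(u^* )\ge0$ for all $u\in\Gamma$. Standing assumptions. (A1) (VIP) has a solution. (A2) $G$ is $L$-Lipschitz on $\mathbf U$. (A3) $J$ is proper, convex and lower semicontinuous (not necessarily differentiable). (A4) $\Theta$ is $\mathbf C$-convex: $\Theta(au+(1-a)v)-a\Theta(u)-(1-a)\Theta(v)\in-\mathbf C$ for all $u,v\in\mathbf U$, $a\in[0,1]$. (A5) $\Theta$ is Lipschitz with constant $\tau>0$ on an open set $\mathcal O\supseteq\mathbf U$. (A6) If $\operatorname{int}\mathbf C\ne\emptyset$ then $\Theta(\mathbf U)\cap(-\operatorname{int}\mathbf C)\neq\emptyset$; if $\mathbf C=\{0\}$ then $0\in\operatorname{int}\Theta(\mathbf U)$. System (MVIS): $(u^\natural,p^\natural)\in\mathbf U\times\mathbf C^*$ such that $\langle G(u),u-u^\natural\rangle+J(u)-J(u^\natural)+\langle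 p^\natural,\Theta(u)-\Theta(u^\natural)\rangle\ge0$ for all $u\in\mathbf U$ and $\langle\Theta(u^\natural),p-p^\natural\rangle\le0$ for all $p\in\mathbf C^*$; its solution set is $\mathbb S_{\mathrm{MVIS}}$. KKT mapping: $$H(u,p)=\begin{pmatrix}G(u)+\partial J(u)+(\partial\Theta(u))^\top p+\mathcal N_{\mathbf U}(u)\\-\Theta(u)+\mathcal N_{\mathbf C^*}(p)\end{pmatrix},$$ where $\mathcal N_{\mathbf S}(x)=\{\xi:\langle\xi,\zeta-x\rangle\le0\ \forall\zeta\in\mathbf S\}$ is the normal cone, $\partial J$ is the convex subdifferential, $\partial\Theta(u)$ is the (Clarke) generalized Jacobian of $\Theta$ at $u$ and $(\partial\Theta(u))^\top p=\{A^\top p:A\in\partial\Theta(u)\}$. Algorithm ALAVI. Parameters $\eta\in(0,1)$, $\alpha>0$, $\gamma>0$. Start from $u^0\in\mathbf U$, $v^0\in\mathbb R^n$, $p^0\in\mathbb R^m$. For $k\ge0$: $q^k=\Pi(p^k+\gamma\Theta(u^k))$; $u^{k+1}=\arg\min_{u\in\mathbf U}\{\langle G(u^k),u\rangle+J(u)+\langle q^k,\Theta(u)\rangle+\frac1{2\alpha}\|u-v^k\|^2\}$; $p^{k+1}=\Pi(p^k+\gamma\Theta(u^{k+1}))$; $v^{k+1}=(1-\eta)u^{k+1}+\eta v^k$. *)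

(* Defs.v *)
From mathcomp Require Export all_boot all_order all_algebra.
From mathcomp Require Export all_classical all_reals all_analysis.
Export Order.TTheory GRing.Theory Num.Theory numFieldNormedType.Exports.

Set Implicit Arguments.
Unset Strict Implicit.
Unset Printing Implicit Defensive.

Local Open Scope classical_set_scope.
Local Open Scope ring_scope.

(* Vectors of R^n are row vectors. The library norm on ['rV[R]_n] is the sup
   norm: it is used only for topological notions (closed, open, interior,
   continuity, limits, Frechet differentiability), on which it agrees with the
   Euclidean norm [enorm]. Every quantitative notion uses [enorm]. *)

Definition dot (R : realType) (n : nat) (x y : 'rV[R]_n) : R :=
  \sum_(i < n) x ord0 i * y ord0 i.

Definition enorm (R : realType) (n : nat) (x : 'rV[R]_n) : R :=
  Num.sqrt (dot x x).

Definition elipschitz (R : realType) (n m : nat) (k : R) (A : set 'rV[R]_n)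
    (f : 'rV[R]_n -> 'rV[R]_m) : Prop :=
  forall x y, A x -> A y -> enorm (f x - f y) <= k * enorm (x - y).

Definition argmin (R : realType) (T : Type) (A : set T) (f : T -> \bar R) :
    set T :=
  [set x | A x /\ forall y, A y -> (f x <= f y)%E].

(* The set of Euclidean nearest points of [S] to [x]: for [S] nonempty, closed
   and convex it is the singleton of the usual projection. *)
Definition proj (R : realType) (n : nat) (S : set 'rV[R]_n) (x : 'rV[R]_n) :
    set 'rV[R]_n :=
  argmin S (fun y => (enorm (x - y))%:E).

(* Equals +oo when [S] is empty. *)
Definition dist0 (R : realType) (n : nat) (S : set 'rV[R]_n) : \bar R :=
  ereal_inf [set (enorm x)%:E | x in S].

Definition cone (R : realType) (n : nat) (C : set 'rV[R]_n) : Prop :=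
  forall (t : R) x, 0 <= t -> C x -> C (t *: x).

Definition dual_cone (R : realType) (n : nat) (C : set 'rV[R]_n) :
    set 'rV[R]_n :=
  [set q | forall theta, C theta -> 0 <= dot q theta].

Definition opp_set (R : realType) (n : nat) (C : set 'rV[R]_n) :
    set 'rV[R]_n :=
  [set - x | x in C].

Definition normal_cone (R : realType) (n : nat) (S : set 'rV[R]_n)
    (x : 'rV[R]_n) : set 'rV[R]_n :=
  [set xi | forall zeta, S zeta -> dot xi (zeta - x) <= 0].

Definition proper (R : realType) (n : nat) (J : 'rV[R]_n -> \bar R) : Prop :=
  (forall x, J x != -oo%E) /\ (exists x, J x != +oo%E).

(* The right-hand side is well defined for [J] nowhere equal to -oo. *)
Definition econvex (R : realType) (n : nat) (J : 'rV[R]_n -> \bar R) : Prop :=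
  forall (x y : 'rV[R]_n) (t : R), 0 < t < 1 ->
    (J (t *: x + (1 - t) *: y)%R <= t%:E * J x + (1 - t)%:E * J y)%E.

Definition subdifferential (R : realType) (n : nat) (J : 'rV[R]_n -> \bar R)
    (x : 'rV[R]_n) : set 'rV[R]_n :=
  [set xi | forall y, (J x + (dot xi (y - x))%:E <= J y)%E].

Definition cone_convex (R : realType) (n m : nat) (C : set 'rV[R]_m)
    (U : set 'rV[R]_n) (Theta : 'rV[R]_n -> 'rV[R]_m) : Prop :=
  forall x y (a : R), U x -> U y -> 0 <= a <= 1 ->
    opp_set C (Theta (a *: x + (1 - a) *: y)
               - a *: Theta x - (1 - a) *: Theta y).

(* Limits of Jacobians at differentiability points converging to [x]. The
   library matrix [jacobian f x] acts on row vectors by right multiplication;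
   its transpose is the usual m x n Jacobian. *)
Definition limiting_jacobian (R : realType) (n m : nat)
    (f : 'rV[R]_n -> 'rV[R]_m) (x : 'rV[R]_n) : set 'M[R]_(m, n) :=
  [set A | exists y : nat -> 'rV[R]_n,
    [/\ forall i, differentiable f (y i),
        y @ \oo --> x &
        (fun i => (jacobian f (y i))^T) @ \oo --> A]].

Definition clarke_jacobian (R : realType) (n m : nat)
    (f : 'rV[R]_n -> 'rV[R]_m) (x : 'rV[R]_n) : set 'M[R]_(m, n) :=
  smallest (@convex_set R 'M[R]_(m, n)) (limiting_jacobian f x).

Definition feasible (R : realType) (n m : nat) (Theta : 'rV[R]_n -> 'rV[R]_m)
    (U : set 'rV[R]_n) (C : set 'rV[R]_m) : set 'rV[R]_n :=
  [set x | U x /\ opp_set C (Theta x)].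

Definition VIP (R : realType) (n m : nat) (G : 'rV[R]_n -> 'rV[R]_n)
    (J : 'rV[R]_n -> \bar R) (Theta : 'rV[R]_n -> 'rV[R]_m)
    (U : set 'rV[R]_n) (C : set 'rV[R]_m) : set 'rV[R]_n :=
  [set x | feasible Theta U C x /\
    forall y, feasible Theta U C y ->
      (0 <= (dot (G x) (y - x))%:E + J y - J x)%E].

Definition MVIS (R : realType) (n m : nat) (G : 'rV[R]_n -> 'rV[R]_n)
    (J : 'rV[R]_n -> \bar R) (Theta : 'rV[R]_n -> 'rV[R]_m)
    (U : set 'rV[R]_n) (C : set 'rV[R]_m) : set ('rV[R]_n * 'rV[R]_m) :=
  [set z | [/\ U z.1, dual_cone C z.2,
    forall x, U x ->
      (0 <= (dot (G x) (x - z.1))%:E + J x - J z.1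
            + (dot z.2 (Theta x - Theta z.1))%:E)%E &
    forall p, dual_cone C p -> dot (Theta z.1) (p - z.2) <= 0]].

(* The pair of components is concatenated into one vector of R^(n + m). For
   row vectors, [p *m A] is the transpose of [A^T p]. *)
Definition KKT (R : realType) (n m : nat) (G : 'rV[R]_n -> 'rV[R]_n)
    (J : 'rV[R]_n -> \bar R) (Theta : 'rV[R]_n -> 'rV[R]_m)
    (U : set 'rV[R]_n) (C : set 'rV[R]_m)
    (x : 'rV[R]_n) (p : 'rV[R]_m) : set 'rV[R]_(n + m) :=
  [set h | exists xi A nu mu,
    [/\ subdifferential J x xi, clarke_jacobian Theta x A,
        normal_cone U x nu, normal_cone (dual_cone C) p mu &
        h = row_mx (G x + xi + p *m A + nu) (- Theta x + mu)]].

Definition ALAVI (R : realType) (n m : nat) (G : 'rV[R]_n -> 'rV[R]_n)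
    (J : 'rV[R]_n -> \bar R) (Theta : 'rV[R]_n -> 'rV[R]_m)
    (U : set 'rV[R]_n) (C : set 'rV[R]_m) (eta alpha gamma : R)
    (v u : nat -> 'rV[R]_n) (p q : nat -> 'rV[R]_m) : Prop :=
  U (u 0%N) /\
  forall k : nat,
    [/\ proj (dual_cone C) (p k + gamma *: Theta (u k)) (q k),
        argmin U (fun x => (dot (G (u k)) x)%:E + J x + (dot (q k) (Theta x))%:E
                           + ((2 * alpha)^-1 * enorm (x - v k) ^+ 2)%:E)%E
               (u k.+1),
        proj (dual_cone C) (p k + gamma *: Theta (u k.+1)) (p k.+1) &
        v k.+1 = (1 - eta) *: u k.+1 + eta *: v k].

Definition iterate (R : realType) (n m : nat) (v u : nat -> 'rV[R]_n)
    (p : nat -> 'rV[R]_m) (k : nat) : 'rV[R]_(n + (n + m)) :=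
  row_mx (v k) (row_mx (u k) (p k)).

(* Main.v *)
(* The iteration is a golden-ratio scheme.  Adding the variational inequality of
   step k+1 tested at a solution u* of (MVIS), that of step k tested at the next
   iterate, Minty's inequality at the current one, and the inequalities of the
   projections defining p and q, all cross terms are absorbed (this is where
   eta^2 + eta >= 1 and the bound on alpha enter), and a Lyapunov function drops
   at each step by a multiple of the squared residual.  The squared residuals are
   therefore summable, and a lower bound c / sqrt k on the residual would
   contradict the divergence of the harmonic series.

   For the KKT residual, optimality of u^{k+1} must produce an element of
   dJ + (dTheta)^T q + N_U.  The support function of (dTheta)^T q dominates the
   directional growth of <q, Theta>, because a Lipschitz map is differentiable
   almost everywhere on almost every line of a given direction (Rademacher and
   Fubini).  Two applications of the sandwich form of the Hahn-Banach theorem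
   then split off the three terms.

   Rademacher's theorem is proved along the lines of Nekvinda and Zajicek: on a
   line of direction u, the points where the directional derivatives along u, v
   and u + v exist but are not additive are countable. *)
From HB Require Import structures.
Require Import Defs.
From mathcomp Require Import ring lra measurable_realfun.

Set Implicit Arguments.
Unset Strict Implicit.
Unset Printing Implicit Defensive.

Local Open Scope classical_set_scope.
Local Open Scope ring_scope.

(** * Euclidean space *)

(** The obstacle in the KKT part is that [Theta] is [C]-convex on [U] only, while its Clarke
    Jacobian at a point of [U], possibly a boundary point, is built from values in a full
    neighbourhood. Near such a point <q, Theta> need not be convex, so the convex sum rule cannot be
    applied to it. It is replaced by its majorant, the support function of the set of all q A with A
    in the Clarke Jacobian, which is convex on the whole space. A given segment may consist of
    points where [Theta] is not differentiable, so the comparison is made on nearby parallel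
    segments. Separating J from the normal cone of [U] needs a qualification condition. It comes
    from the continuity of the extended-valued [J] at the points of [U], which makes [J] finite
    around each of them. Separation from the Clarke Jacobian is carried out up to an arbitrary error
    e > 0. This suffices because the distance from 0 to H is an infimum. *)

Lemma mx_norm_ge (R : realType) (n : nat) (x : 'rV[R]_n) i : `|x 0 i| <= `|x|.
Proof. by rewrite [leRHS]/Num.norm/= mx_normrE; apply: (le_bigmax _ _ (0, i)). Qed.

Lemma mx_norm_le (R : realType) (n : nat) (x : 'rV[R]_n) (r : R) : 0 <= r ->
  (forall i, `|x 0 i| <= r) -> `|x| <= r.
Proof.
move=> r0 xr; rewrite [leLHS]/Num.norm/= mx_normrE.
by apply/bigmax_leP; split => // -[j i] _ /=; rewrite ord1.
Qed.

Lemma mx_norm_lt (R : realType) (n : nat) (x : 'rV[R]_n) (r : R) : 0 < r ->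
  (`|x| < r) = [forall i, `|x 0 i| < r].
Proof.
move=> r0; apply/idP/forallP => [xr i|xr].
  exact: le_lt_trans (mx_norm_ge _ _) xr.
rewrite [ltLHS]/Num.norm/= mx_normrE; apply/bigmax_ltP; split => // -[j i] _.
by rewrite ord1; exact: xr.
Qed.

Section euclidean.
Variables (R : realType) (n : nat).
Implicit Types (x y z : 'rV[R]_n) (c : R).

Lemma dotC x y : dot x y = dot y x.
Proof. by apply: eq_bigr => i _; rewrite mulrC. Qed.

Lemma dotDl x y z : dot (x + y) z = dot x z + dot y z.
Proof. by rewrite /dot -big_split; apply: eq_bigr => i _; rewrite mxE mulrDl. Qed.

Lemma dotDr x y z : dot x (y + z) = dot x y + dot x z.
Proof. by rewrite dotC dotDl !(dotC x). Qed.

Lemma dotZl c x y : dot (c *: x) y = c * dot x y.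
Proof. by rewrite /dot mulr_sumr; apply: eq_bigr => i _; rewrite mxE mulrA. Qed.

Lemma dotZr c x y : dot x (c *: y) = c * dot x y.
Proof. by rewrite dotC dotZl dotC. Qed.

Lemma dotNl x y : dot (- x) y = - dot x y.
Proof. by rewrite -scaleN1r dotZl mulN1r. Qed.

Lemma dotNr x y : dot x (- y) = - dot x y.
Proof. by rewrite dotC dotNl dotC. Qed.

Lemma dotBl x y z : dot (x - y) z = dot x z - dot y z.
Proof. by rewrite dotDl dotNl. Qed.

Lemma dotBr x y z : dot x (y - z) = dot x y - dot x z.
Proof. by rewrite dotDr dotNr. Qed.

Lemma dot0l x : dot 0 x = 0.
Proof. by rewrite -(scale0r 0) dotZl mul0r. Qed.

Lemma dot0r x : dot x 0 = 0.
Proof. by rewrite dotC dot0l. Qed.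

Definition dotE := (dotDl, dotDr, dotNl, dotNr, dotZl, dotZr).

Lemma dot_ge0 x : 0 <= dot x x.
Proof. by apply: sumr_ge0 => i _; rewrite -expr2 sqr_ge0. Qed.

Lemma dot_eq0 x : dot x x = 0 -> x = 0.
Proof.
move=> /eqP; rewrite psumr_eq0 => [|i _]; last by rewrite -expr2 sqr_ge0.
move=> /allP x0; apply/rowP => i; rewrite mxE; apply/eqP.
by have := x0 i (mem_index_enum i); rewrite mulf_eq0 orbb.
Qed.

Lemma enorm_ge0 x : 0 <= enorm x.
Proof. exact: sqrtr_ge0. Qed.

Lemma enorm_sqr x : enorm x ^+ 2 = dot x x.
Proof. by rewrite sqr_sqrtr// dot_ge0. Qed.

Lemma enorm0 : enorm (0 : 'rV[R]_n) = 0.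
Proof. by rewrite /enorm dot0l sqrtr0. Qed.

Lemma enormZ c x : enorm (c *: x) = `|c| * enorm x.
Proof.
by rewrite /enorm dotZl dotZr mulrA -expr2 sqrtrM ?sqr_ge0// sqrtr_sqr.
Qed.

Lemma enormN x : enorm (- x) = enorm x.
Proof. by rewrite -scaleN1r enormZ normrN1 mul1r. Qed.

Lemma enormBC x y : enorm (x - y) = enorm (y - x).
Proof. by rewrite -enormN opprB. Qed.

Lemma cauchy_schwarz x y : `|dot x y| <= enorm x * enorm y.
Proof.
have [y0|y0] := eqVneq (dot y y) 0.
  by rewrite (dot_eq0 y0) dot0r normr0 enorm0 mulr0.
rewrite -(@ler_pXn2r _ 2) ?nnegrE//; last by rewrite mulr_ge0 ?enorm_ge0.
rewrite exprMn !enorm_sqr -normrX ger0_norm ?sqr_ge0//.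
have yy : 0 < dot y y by rewrite lt_neqAle eq_sym y0 dot_ge0.
have := dot_ge0 (dot y y *: x - dot x y *: y).
rewrite !dotE (dotC y x) => H.
have : 0 <= dot y y * (dot x x * dot y y - dot x y ^+ 2).
  by rewrite (le_trans H)// le_eqVlt; apply/orP; left; apply/eqP; ring.
by rewrite pmulr_rge0// subr_ge0.
Qed.

Lemma dot_le x y : dot x y <= enorm x * enorm y.
Proof. exact: le_trans (ler_norm _) (cauchy_schwarz _ _). Qed.

Lemma enormD x y : enorm (x + y) <= enorm x + enorm y.
Proof.
rewrite -(@ler_pXn2r _ 2) ?nnegrE ?addr_ge0 ?enorm_ge0//.
rewrite sqrrD !enorm_sqr !dotE (dotC y x); have := dot_le x y; lra.
Qed.

Lemma enormB x y : enorm (x - y) <= enorm x + enorm y.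
Proof. by apply: le_trans (enormD _ _) _; rewrite enormN. Qed.

Lemma enorm_mx_norm x : `|x| <= enorm x.
Proof.
apply: mx_norm_le => [|i]; first exact: enorm_ge0.
rewrite -(@ler_pXn2r _ 2) ?nnegrE ?enorm_ge0// enorm_sqr.
rewrite -normrX ger0_norm ?sqr_ge0// /dot (bigD1 i)//= expr2 lerDl.
by apply: sumr_ge0 => k _; rewrite -expr2 sqr_ge0.
Qed.

Lemma mx_norm_enorm x : enorm x <= n%:R * `|x|.
Proof.
have [x0|x0] := eqVneq x 0; first by rewrite x0 enorm0 normr0 mulr0.
rewrite -(@ler_pXn2r _ 2) ?nnegrE ?mulr_ge0 ?enorm_ge0// enorm_sqr exprMn.
apply: (@le_trans _ _ (\sum_(i < n) `|x| ^+ 2)).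
  apply: ler_sum => i _; rewrite -expr2 -[leLHS]ger0_norm ?sqr_ge0// normrX.
  by rewrite ler_pXn2r ?nnegrE// mx_norm_ge.
rewrite sumr_const card_ord -[leLHS]mulr_natl ler_wpM2r ?sqr_ge0//.
by rewrite -natrX ler_nat; case: (n) => // k; rewrite -[leqLHS]expn1 leq_pexp2l.
Qed.

End euclidean.

(** * Lipschitz functions of one real variable *)

Definition clamp (R : realType) (a b t : R) := Num.max a (Num.min t b).

Lemma clamp_lipschitz (R : realType) (a b s t : R) : a <= b ->
  `|clamp a b s - clamp a b t| <= `|s - t|.
Proof.
move=> ab; have := ler_norm (s - t); have := ler_norm (t - s); rewrite distrC.
rewrite ler_norml /clamp !maxEle !minEle.
by do !case: ifPn; rewrite -?ltNge => *; apply/andP; split; lra.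
Qed.

Lemma lipschitz_continuous (R : realType) (V W : normedModType R) (K : R)
    (f : V -> W) :
  (forall x y, `|f x - f y| <= K * `|x - y|) -> continuous f.
Proof.
move=> lipf x.
have K'0 : 0 < Num.max K 1 by rewrite lt_max ltr01 orbT.
apply/(@cvgrPdist_le _ W) => e e0; near=> y.
apply: le_trans (lipf _ _) _.
apply: (@le_trans _ _ (Num.max K 1 * `|x - y|)).
  by rewrite ler_wpM2r// le_max lexx.
rewrite -ler_pdivlMl//.
near: y; apply: (@cvgr_dist_le _ V _ _ _ id); first exact: cvg_id.
by rewrite mulr_gt0// invr_gt0.
Unshelve. all: by end_near. Qed.

Lemma le_lip_nondecreasing (R : realType) (f : R -> R) (K : R) :
  (forall x y, x <= y -> 0 <= f y - f x <= K * (y - x)) ->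
  forall x y, `|f x - f y| <= K * `|x - y|.
Proof.
move=> lipf x y; wlog xy : x y / x <= y.
  by move=> H; have [/H//|/ltW/H] := leP x y; rewrite distrC (distrC x).
have /andP[fxy fyx] := lipf _ _ xy.
by rewrite distrC (distrC x) !ger0_norm ?subr_ge0// -subr_ge0.
Qed.

(** Both [phi] and K x - [phi] are nondecreasing, and their Stieltjes measures add up to K times
    Lebesgue measure. Hence the measure of [phi] is absolutely continuous, and its Radon-Nikodym
    derivative is the density. *)
Lemma cumulative_density (R : realType) (phi : cumulativeBounded (0 : R) (1 : R))
    (K : R) :
  0 < K -> (forall x y, x <= y -> phi y - phi x <= K * (y - x)) ->
  exists g : R -> R, lebesgue_measure.-integrable setT (EFin \o g) /\
    forall x y, x <= y ->
      phi y - phi x = \int[lebesgue_measure]_(t in `]x, y]) g t.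
Proof.
move=> K0 lipphi.
have cphi : continuous (fun x : R => phi x).
  apply: (@lipschitz_continuous _ R^o R^o K); apply: le_lip_nondecreasing => x y xy.
  by rewrite lipphi// andbT subr_ge0; exact: cumulative_is_nondecreasing.
pose psi0 := fun x : R => K * x - phi x.
have psi_nd : {homo psi0 : x y / x <= y}.
  move=> x y xy; rewrite /psi0; have := lipphi _ _ xy; lra.
have psi_rc : forall x, psi0 @ x^'+ --> psi0 x.
  apply: right_continuousW => x; apply: cvgB; last exact: cphi.
  by apply: cvgM; [exact: cvg_cst|exact: cvg_id].
pose psi : cumulative R R := HB.pack psi0 (isCumulative.Build R _ R psi0 psi_nd psi_rc).
have K'0 : 0 <= K^-1 by rewrite invr_ge0 ltW.
pose nu := mscale (NngNum K'0) (measure_add (lebesgue_stieltjes_measure phi)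
  (lebesgue_stieltjes_measure psi)).
have nuAE A : nu A = ((K^-1)%:E * (lebesgue_stieltjes_measure phi A +
    lebesgue_stieltjes_measure psi A))%E.
  by rewrite -measure_addE.
have lsE (h : cumulative R R) (x y : R) : x <= y ->
    lebesgue_stieltjes_measure h `]x, y]%classic = (h y - h x)%:E.
  move=> xy.
  rewrite /lebesgue_stieltjes_measure /measure_extension measurable_mu_extE/=;
    last exact: is_ocitv.
  by rewrite wlength_itv_bnd.
have nuE : forall A, measurable A -> lebesgue_measure A = nu A.
  apply: lebesgue_measure_unique => _ [[x y] _ <-].
  rewrite /= [RHS]nuAE /=.
  have [xy|yx] := leP x y; last first.
    by rewrite set_itv_ge -?leNgt ?bnd_simp ?ltW// !measure0 adde0 mule0.
  rewrite lebesgue_measure_itv/= lte_fin.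
  rewrite (lsE phi)// (lsE psi)// -EFinD -EFinM /= /psi0.
  move: xy; rewrite le_eqVlt => /predU1P[->|xy].
    by rewrite ltxx; congr EFin; lra.
  rewrite xy. by congr EFin; field; rewrite gt_eqF.
have dom : lebesgue_stieltjes_measure phi `<< @lebesgue_measure R.
  apply/null_content_dominatesP => A mA A0.
  have := nuE _ mA; rewrite A0 [X in _ = X]nuAE => /esym/eqP.
  rewrite mule_eq0 eqe invr_eq0 gt_eqF//= => /eqP H.
  apply/eqP; rewrite eq_le measure_ge0 andbT -[leRHS]H leeDl//.
have [g [g0 gfin gint gE]] := radon_nikodym_sigma_finite dom.
have gEE : EFin \o (fine \o g) = g by apply/funext => x /=; rewrite fineK.
exists (fine \o g); split; first by rewrite gEE.
move=> x y xy; rewrite /Rintegral.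
under eq_integral => t _ do rewrite /= fineK//.
by rewrite -gE//= lsE.
Qed.

Lemma integrable_cst_itvoc (R : realType) (a b k : R) :
  lebesgue_measure.-integrable `]a, b] (fun=> k%:E).
Proof.
apply/integrableP; split; first exact: measurable_cst.
rewrite integral_cst; last exact: measurable_itv.
rewrite /= lebesgue_measure_itv /= lte_fin.
by case: ifP => _; rewrite ?mule0// -EFinB -EFinM ltry.
Qed.

(** The function f(x) + (K + 1) x is increasing. Frozen outside [a, b] by [clamp] and normalised, it
    is a distribution function with limits 0 and 1, so [cumulative_density] applies. The density of
    [f] follows by undoing the affine change, and the fundamental theorem of calculus identifies it
    with the derivative almost everywhere. *)
Lemma lipschitz_density (R : realType) (f : R -> R) (K a b : R) :
  0 <= K -> (forall x y, `|f x - f y| <= K * `|x - y|) -> a < b ->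
  exists g : R -> R, [/\ lebesgue_measure.-integrable `]a, b] (EFin \o g),
    f b - f a = \int[lebesgue_measure]_(t in `]a, b]) g t &
    {ae @lebesgue_measure R, forall x, a < x < b ->
      derivable f x 1 /\ derive1 f x = g x}].
Proof.
move=> K0 lipf ab.
pose cl := clamp a b.
have cl_lip x y : `|cl x - cl y| <= `|x - y| := clamp_lipschitz _ _ (ltW ab).
have cl_nd x y : x <= y -> cl x <= cl y.
  move=> xy; rewrite /cl /clamp !maxEle !minEle.
  by do !case: ifPn; rewrite -?ltNge => *; lra.
have clE x : a <= x <= b -> cl x = x.
  by move=> /andP[ax xb]; rewrite /cl /clamp min_l// max_r.
have cl_a x : x <= a -> cl x = a.
  by move=> xa; rewrite /cl /clamp max_l// ge_min xa.
have cl_b x : b <= x -> cl x = b.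
  by move=> bx; rewrite /cl /clamp min_r// max_r// ltW.
(* The total increase, used for normalisation. With slope K + 1 instead of K it is at least b - a,
   hence positive. *)
pose M := f b - f a + (K + 1) * (b - a).
have M0 : 0 < M.
  have := lipf a b; rewrite (ltr0_norm (x := a - b)) ?subr_lt0// ler_norml => /andP[_].
  by rewrite /M; nra.
pose phi0 x := (f (cl x) - f a + (K + 1) * (cl x - a)) / M.
have phi0D x y : phi0 y - phi0 x = (f (cl y) - f (cl x) + (K + 1) * (cl y - cl x)) / M.
  by rewrite /phi0 -mulrBl; congr (_ / _); lra.
have phi_nd : {homo phi0 : x y / x <= y}.
  move=> x y xy; rewrite -subr_ge0 phi0D divr_ge0//; last exact: ltW.
  have := lipf (cl x) (cl y); have := cl_nd _ _ xy => cxy.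
  by rewrite (ler0_norm (x := cl x - _)) ?subr_le0// ler_norml => /andP[_]; nra.
have phi_lip x y : x <= y -> phi0 y - phi0 x <= ((2 * K + 1) / M) * (y - x).
  move=> xy; rewrite phi0D mulrAC ler_pM2r ?invr_gt0//.
  have := lipf (cl x) (cl y); have := cl_nd _ _ xy => cxy.
  rewrite (ler0_norm (x := cl x - _)) ?subr_le0// ler_norml => /andP[+ _].
  have := cl_lip x y; rewrite !ler0_norm ?subr_le0//; nra.
have C0 : 0 < (2 * K + 1) / M by rewrite divr_gt0//; lra.
have phi_c : continuous phi0.
  apply: (@lipschitz_continuous _ R^o R^o ((2 * K + 1) / M)).
  by apply: le_lip_nondecreasing => x y xy; rewrite phi_lip// andbT subr_ge0 phi_nd.
have phi_rc : forall x, phi0 @ x^'+ --> phi0 x by exact: right_continuousW.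
have phi_Ny : phi0 @ -oo --> (0 : R).
  apply: cvg_near_cst; exists a; split; first exact: num_real.
  by move=> x /ltW xa; rewrite /phi0 cl_a// !subrr mulr0 addr0 mul0r.
have phi_y : phi0 @ +oo --> (1 : R).
  apply: cvg_near_cst; exists b; split; first exact: num_real.
  by move=> x /ltW bx; rewrite /phi0 cl_b// divff// gt_eqF.
pose phi : cumulativeBounded (0 : R) (1 : R) := HB.pack phi0
  (isCumulative.Build R _ R phi0 phi_nd phi_rc)
  (isCumulativeBounded.Build R 0 1 phi0 phi_Ny phi_y).
have [h [hint hE]] := @cumulative_density R phi _ C0 phi_lip.
have hintS (A : set R) : measurable A ->
    lebesgue_measure.-integrable A (EFin \o h).
  by move=> mA; apply: integrableS hint.
pose Fh x := \int[lebesgue_measure]_(t in `]-oo, x]) h t.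
have fE x : a <= x <= b -> f x = M * Fh x - (K + 1) * x +
    (f a + (K + 1) * a - M * Fh a).
  move=> /[dup] /andP[ax xb] axb.
  have := hE _ _ ax; rewrite /phi /= -(@Rintegral_itvB _ h -oo%O (BRight x) a)//;
    last first.
    by apply: hintS; exact: measurable_itv.
  rewrite -/(Fh x) -/(Fh a) /phi0 clE// cl_a// !subrr mulr0 addr0 mul0r subr0.
  move=> /(congr1 ( *%R M)); rewrite mulrCA divff ?gt_eqF// mulr1; lra.
exists (fun x => M * h x - (K + 1)); split.
- rewrite (_ : EFin \o _ = (fun x => (M%:E * (EFin \o h) x - (K + 1)%:E)%E)); last first.
    by apply/funext => x; rewrite /= EFinB EFinM.
  apply: integrableB => //.
  + by apply: integrableZl => //; apply: hintS; exact: measurable_itv.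
  + exact: integrable_cst_itvoc.
- rewrite RintegralB//=; first last.
  + exact: integrable_cst_itvoc.
  + rewrite (_ : EFin \o _ = (fun x => (M%:E * (EFin \o h) x)%E))//.
    by apply: integrableZl => //; apply: hintS; exact: measurable_itv.
  rewrite RintegralZl//; last by apply: hintS; exact: measurable_itv.
  rewrite Rintegral_cst//. rewrite [X in fine X](_ : _ = (b - a)%:E); last first.
    by apply: etrans (lebesgue_measure_itv _) _; rewrite /= lte_fin ab EFinB.
  have := hE _ _ (ltW ab); rewrite /phi /= /phi0 !clE ?lexx ?(ltW ab)// => <-.
  rewrite !subrr mulr0 addr0 mul0r subr0 mulrCA divff ?gt_eqF// mulr1 /M; lra.
- have := @FTC1Ny R h (fun y => hintS _ (measurable_itv _))
    (open_integrable_locally openT hint).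
  apply: filterS; first exact: (ae_filter_ringOfSetsType (@lebesgue_measure R)).
  move=> x [dFh Fh'] /andP[ax xb].
  have fFh : {near x, (fun y => M * Fh y - (K + 1) * y +
      (f a + (K + 1) * a - M * Fh a)) =1 f}.
    near=> y; rewrite [RHS]fE//; apply/andP; split; apply/ltW; near: y.
      exact: lt_nbhsr.
    exact: lt_nbhsl.
  have D : is_derive x 1 f (M * h x - (K + 1)).
    have dF : is_derive x 1 (Fh : R^o -> R^o) (h x).
      by rewrite -Fh' derive1E; exact: derivableP.
    have : {near x, (M \*: Fh - (K + 1) \*: id +
      cst (f a + (K + 1) * a - M * Fh a) : R^o -> R^o) =1 f} by exact: fFh.
    move/near_eq_is_derive; apply.
    by apply: is_derive_eq; rewrite addr0 /GRing.scale/= mulr1.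
  by split; [exact: ex_derive | rewrite derive1E derive_val].
Unshelve. all: by end_near. Qed.

Lemma lipschitz_ae_derivable (R : realType) (f : R -> R) (K : R) :
  0 <= K -> (forall x y, `|f x - f y| <= K * `|x - y|) ->
  (@lebesgue_measure R).-negligible [set x | ~ derivable f x 1].
Proof.
move=> K0 lipf.
pose N (n : nat) := [set x | ~ (- n.+1%:R < x < n.+1%:R -> derivable f x 1)].
have N0 n : (@lebesgue_measure R).-negligible (N n).
  have nn : - n.+1%:R < n.+1%:R :> R by rewrite ltrNl -subr_gt0 opprK addr_gt0.
  have [g [_ _ H]] := lipschitz_density K0 lipf nn.
  apply: negligibleS H => x /= Nx H.
  by apply: Nx => /H[].
apply: negligibleS (negligible_bigcup N0) => x /= Nx.
exists (Num.bound x) => // H; apply: Nx; apply: H.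
rewrite -ltr_norml (lt_trans (archi_boundP _))//.
by rewrite ltr_nat ltnS /Num.bound normr_id.
Qed.

Lemma lipschitz_derive_le (R : realType) (f : R -> R) (K a b c : R) :
  0 <= K -> (forall x y, `|f x - f y| <= K * `|x - y|) -> a <= b ->
  {ae @lebesgue_measure R, forall x, a < x < b -> derivable f x 1 ->
    derive1 f x <= c} ->
  f b - f a <= c * (b - a).
Proof.
move=> K0 lipf; rewrite le_eqVlt => /predU1P[<- _|ab fc].
  by rewrite !subrr mulr0.
have [g [gint -> gE]] := lipschitz_density K0 lipf ab.
have -> : c * (b - a) = \int[lebesgue_measure]_(t in `]a, b]) c.
  rewrite Rintegral_cst// [X in fine X](_ : _ = (b - a)%:E)//.
  by apply: etrans (lebesgue_measure_itv _) _; rewrite /= lte_fin ab EFinB.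
rewrite -subr_ge0 -RintegralB//; last exact: integrable_cst_itvoc.
have mab : measurable (`]a, b]%classic : set R) by exact: measurable_itv.
pose h (x : R) : \bar R := (c - g x)%:E.
have ih : lebesgue_measure.-integrable `]a, b] h.
  rewrite (_ : h = (fun x => (c%:E - (EFin \o g) x)%E))//.
  by apply: integrableB => //; exact: integrable_cst_itvoc.
have mh := measurable_int _ ih.
rewrite /Rintegral fine_ge0//.
(* The integrand is nonnegative only almost everywhere; its positive part is nonnegative everywhere
   and has the same integral. *)
rewrite [leRHS](_ : _ = \int[lebesgue_measure]_(x in `]a, b]) (h^\+ x))%E.
  by apply: integral_ge0 => x _; rewrite funepos_ge0.
apply: ae_eq_integral => //.
- exact: measurable_realfun.measurable_funepos.
- have Nb : (@lebesgue_measure R).-negligible [set b].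
    by exists [set b]; split => //; exact: lebesgue_measure_set1.
  have b' : {ae @lebesgue_measure R, forall x, x <> b}.
    by apply: negligibleS Nb => x /= /contrapT.
  have Fae := ae_filter_ringOfSetsType (@lebesgue_measure R).
  apply: filterS3 gE fc b' => x gx fcx xb; rewrite /= in_itv/= => /andP[ax xb'].
  have axb : a < x < b by rewrite ax lt_neqAle xb' andbT; apply/eqP.
  have [dfx fgx] := gx axb; have := fcx axb dfx; rewrite fgx => gc.
  by rewrite funeposE max_l// lee_fin subr_ge0.
Qed.

(** * Translation-invariant measure *)

Definition borel_mx (R : realType) (n : nat) : set (set 'rV[R]_n) := <<s open >>.

Lemma rat_dense_mx (R : realType) (n : nat) (x : 'rV[R]_n) (e : R) : 0 < e ->
  exists c : 'rV[rat]_n, `|x - map_mx ratr c| < e.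
Proof.
move=> e0.
have H i : exists q : rat, `|x 0 i - ratr q| < e.
  have xe : x 0 i - e < x 0 i + e by lra.
  have [q] := rat_in_itvoo xe.
  rewrite in_itv/= => /andP[qx xq]; exists q; rewrite ltr_norml; apply/andP; split; lra.
have [c cE] := choice H.
exists (\row_i c i); rewrite mx_norm_lt//; apply/forallP => i.
by rewrite !mxE.
Qed.

Lemma open_bigcup_ball (R : realType) (n : nat) (O : set 'rV[R]_n) : open O ->
  O = \bigcup_(z in [set z : 'rV[rat]_n * nat |
      ball (map_mx ratr z.1 : 'rV[R]_n) z.2.+1%:R^-1 `<=` O])
    ball (map_mx ratr z.1 : 'rV[R]_n) z.2.+1%:R^-1.
Proof.
move=> oO; apply/seteqP; split => [x Ox|x [z /= zO /zO]//].
have /nbhs_ballP[e /= e0 eO] : nbhs x O by apply: open_nbhs_nbhs.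
have e20 : 0 < e / 2 by rewrite divr_gt0.
have [k _ /(_ k (leqnn k)) ke] := near_infty_natSinv_lt (PosNum e20).
have k0 : 0 < k.+1%:R^-1 :> R by rewrite invr_gt0.
have [c xc] := rat_dense_mx x k0.
have cx : ball (map_mx ratr c : 'rV[R]_n) k.+1%:R^-1 x.
  by rewrite mx_norm_ball /ball_ /= distrC.
exists (c, k) => //= y cy; apply: eO; apply: (@le_ball _ _ _ (k.+1%:R^-1 + k.+1%:R^-1)).
  have {}ke : k.+1%:R^-1 < e / 2 :> R := ke.
  by rewrite (le_trans (lerD (ltW ke) (ltW ke)))// -splitr.
exact: ball_triangle (ball_sym cx) cy.
Qed.

(** Measurable coordinates suffice because balls of the sup norm are boxes and every open set is a
    countable union of rational balls. *)
Lemma borel_preimage (R : realType) (n : nat) d (T : measurableType d)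
    (f : T -> 'rV[R]_n) :
  (forall i, measurable_fun setT (fun t => f t 0 i)) ->
  forall E, borel_mx E -> measurable (f @^-1` E).
Proof.
move=> mf; suff : <<s open >> `<=` [set E | measurable (f @^-1` E)] by [].
apply: smallest_sub.
  split.
  - by rewrite /= preimage_set0.
  - by move=> A /= mA; rewrite setTD preimage_setC; exact: measurableC.
  - by move=> F /= mF; rewrite preimage_bigcup; exact: bigcup_measurable.
move=> O /= oO; rewrite (open_bigcup_ball oO) preimage_bigcup.
rewrite bigcup_mkcond; apply: countable_bigcupT_measurable => [|z].
  exact: countableP.
case: ifP => _; last exact: measurable0.
rewrite mx_norm_ball [X in measurable X](_ : _ = \bigcap_(i in [set: 'I_n])
    ((fun t => f t 0 i) @^-1` ball (map_mx ratr z.1 0 i : R) z.2.+1%:R^-1)); last first.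
  apply/seteqP; split => t /=; rewrite mx_norm_lt ?invr_gt0//.
    by move=> /forallP tz i _; have := tz i; rewrite !mxE.
  by move=> tz; apply/forallP => i; have := tz i I; rewrite !mxE.
apply: fin_bigcap_measurable => // i _.
by rewrite -[X in measurable X]setTI; apply: mf => //; exact: measurable_ball.
Qed.

(* Lebesgue measure on R^n, carried by an iterated product space [haar_type]
   that is mapped to row vectors by [haar_vec]. *)
Record haar_space (R : realType) (n : nat) := HaarSpace {
  haar_disp : measure_display ;
  haar_type : measurableType haar_disp ;
  haar_mu : {sigma_finite_measure set haar_type -> \bar R} ;
  haar_vec : haar_type -> 'rV[R]_n ;
  haar_meas : forall i, measurable_fun setT (fun t => haar_vec t 0 i) ;
  haar_shift : forall a : 'rV[R]_n, exists tau : haar_type -> haar_type,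
    [/\ measurable_fun setT tau, forall t, haar_vec (tau t) = haar_vec t + a &
      forall E, measurable E -> haar_mu (tau @^-1` E) = haar_mu E] ;
  haar_pos : forall (c : 'rV[R]_n) (r : R), 0 < r ->
    (0 < haar_mu [set t | forall i, (`|c 0 i - haar_vec t 0 i| < r)%R])%E }.

Lemma haar0 (R : realType) : haar_space R 0.
Proof.
refine (@HaarSpace R 0 _ unit (dirac tt : {sigma_finite_measure set unit -> \bar R})
  (fun=> 0) _ _ _).
- by case.
- move=> a; exists id; split => //; first by move=> t; apply/rowP => -[].
- move=> c r r0; rewrite (_ : mkset _ = setT); last by apply/seteqP; split => // t _ [].
  by rewrite [ltRHS]diracE mem_set ?lte_fin.
Qed.

Lemma lebesgue_measure_shift (R : realType) (a : R) (E : set R) :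
  measurable E ->
  pushforward lebesgue_measure ((fun x => x + a) : R -> measurableTypeR R) E =
  lebesgue_measure E.
Proof.
move=> mE; apply/esym/lebesgue_measure_unique => //=.
  exact: measurable_funD.
move=> mf _ [[x y] _ <-] /=; rewrite /pushforward.
rewrite (_ : _ @^-1` _ = `]x - a, y - a]%classic); last first.
  by apply/seteqP; split => t /=; rewrite !in_itv/= ltrBlDr lerBrDr.
rewrite !lebesgue_measure_itv/= !lte_fin ltrD2r; case: ifP => // _.
by rewrite -!EFinB; congr EFin; ring.
Qed.

Lemma product_measure_sigma_finite (R : realType) d1 d2 (T1 : measurableType d1)
    (T2 : measurableType d2) (m1 : {sigma_finite_measure set T1 -> \bar R})
    (m2 : {sigma_finite_measure set T2 -> \bar R}) :
  sigma_finite setT (m1 \x m2)%E.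
Proof.
have /sigma_finiteP[F [TF ndF foo]] := sigma_finiteT m1.
have /sigma_finiteP[G [TG ndG goo]] := sigma_finiteT m2.
exists (fun n => F n `*` G n) => [|k].
  apply/esym; rewrite -subTset => -[x y] _.
  have [i _ Fi] : (\bigcup_k F k) x by rewrite -TF.
  have [j _ Gj] : (\bigcup_k G k) y by rewrite -TG.
  exists (maxn i j) => //; split => /=.
    by move: Fi; apply/subsetPset/ndF/leq_maxl.
  by move: Gj; apply/subsetPset/ndG/leq_maxr.
have [[mF Foo] [mG Goo]] := (foo k, goo k); split; first exact: measurableX.
by rewrite [ltLHS]product_measure1E// lte_mul_pinfty// ge0_fin_numE.
Qed.

(** A translation acts on the new Lebesgue factor and on the old space separately, so invariance is
    checked on rectangles and extended by uniqueness of the product measure. A sup-norm ball is a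
    product of balls, which gives positivity. *)
Lemma haarS (R : realType) (n : nat) : haar_space R n -> haar_space R n.+1.
Proof.
move=> [d T mu vec meas shift pos].
pose T' := (measurableTypeR R * T)%type.
pose vec' (z : T') : 'rV[R]_n.+1 := row_mx (z.1%:M : 'rV[R]_1) (vec z.2).
have vec0 z : vec' z 0 0 = z.1.
  have -> : vec' z 0 0 = vec' z 0 (lshift n (0 : 'I_1)) by congr (vec' z 0 _); exact/val_inj.
  by apply: etrans (row_mxEl _ _ _ _) _; rewrite mxE eqxx mulr1n.
have vecS z i : vec' z 0 (lift 0 i) = vec z.2 0 i.
  have -> : vec' z 0 (lift 0 i) = vec' z 0 (rshift 1 i) by congr (vec' z 0 _); exact/val_inj.
  exact: row_mxEr.
pose mu' : {sigma_finite_measure set (measurableTypeR R * T)%type -> \bar R} :=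
  HB.pack (lebesgue_measure \x mu)%E (Measure_isSigmaFinite.Build _ _ _
    (lebesgue_measure \x mu)%E (product_measure_sigma_finite lebesgue_measure mu)).
refine (@HaarSpace R n.+1 _ _ mu' vec' _ _ _).
- move=> i; have [j ->|->] := unliftP 0 i.
    rewrite (_ : (fun _ => _) = (fun z : T' => vec z.2 0 j)); last by apply/funext.
    by apply: (measurableT_comp (meas j)); exact: measurable_snd.
  rewrite (_ : (fun _ => _) = (fun z : T' => z.1)); last by apply/funext.
  exact: measurable_fst.
- move=> a.
  have [tau [mtau tauE mutau]] := shift (\row_i a 0 (lift 0 i)).
  pose tau' (z : T') : T' := (z.1 + a 0 0, tau z.2).
  have mtau' : measurable_fun setT tau'.
    apply: measurable_fun_pair; last by apply: (measurableT_comp mtau); exact: measurable_snd.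
    by apply: measurable_funD => //; exact: measurable_fst.
  exists tau'; split => //.
    move=> z; apply/rowP => i; rewrite [RHS]mxE; have [j ->|->] := unliftP 0 i.
      by rewrite !vecS /tau'/= tauE !mxE.
    by rewrite !vec0.
  move=> E mE; symmetry; apply: (product_measure_unique (m1 := lebesgue_measure)
    (m2 := mu) (m' := pushforward (lebesgue_measure \x mu)%E tau')) => //.
  move=> A B mA mB.
  transitivity ((lebesgue_measure \x mu)%E
    (((fun x => x + a 0 0) @^-1` A) `*` (tau @^-1` B))) => //.
  rewrite [LHS]product_measure1E ?mutau//.
  - by congr (_ * _)%E; exact: lebesgue_measure_shift.
  - by rewrite -[X in measurable X]setTI; apply: measurable_funD.
  - by rewrite -[X in measurable X]setTI; apply: mtau.
- move=> c r r0.
  have mB : measurable [set t | forall i, `|(\row_j c 0 (lift 0 j)) 0 i - vec t 0 i| < r].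
    rewrite (_ : mkset _ = vec @^-1` ball (\row_j c 0 (lift 0 j)) r).
      by apply: borel_preimage => //; apply: sub_sigma_algebra; exact: ball_open.
    apply/seteqP; split => t /=; rewrite mx_norm_ball /ball_/= mx_norm_lt//.
      by move=> H; apply/forallP => i; have := H i; rewrite !mxE.
    by move=> /forallP H i; have := H i; rewrite !mxE.
  rewrite (_ : mkset _ = ball (c 0 0) r `*`
    [set t | forall i, `|(\row_j c 0 (lift 0 j)) 0 i - vec t 0 i| < r]); last first.
    apply/seteqP; split => t /=.
      move=> H; split; first by have := H 0; rewrite vec0.
      by move=> i; have := H (lift 0 i); rewrite vecS mxE.
    move=> [H0 H] i; have [j ->|->] := unliftP 0 i.
      by have := H j; rewrite vecS mxE.
    by rewrite vec0.
  rewrite [ltRHS]product_measure1E//; last exact: measurable_ball.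
  apply: mule_gt0; last exact: pos.
  rewrite [ltRHS](_ : _ = (r *+ 2)%:E); first by rewrite lte_fin pmulrn_lgt0.
  by apply: lebesgue_measure_ball; exact: ltW.
Qed.

Lemma haar (R : realType) (n : nat) : haar_space R n.
Proof. by elim: n => [|n]; [exact: haar0 | exact: haarS]. Qed.

Section haar_lines.
Variables (R : realType) (n : nat) (H : haar_space R n) (a : 'rV[R]_n).
Variable E : set 'rV[R]_n.
Hypothesis mE : borel_mx E.
Notation mu := (haar_mu H).
Notation vec := (@haar_vec _ _ H).

Let A : set (haar_type H * measurableTypeR R) :=
  [set z | E (vec z.1 + z.2 *: a)].

Let mA : measurable A.
Proof.
apply: (@borel_preimage _ _ _ _ (fun z : (haar_type H * measurableTypeR R)%type =>
  vec z.1 + z.2 *: a)) => // i.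
rewrite (_ : (fun _ => _) = (fun z => vec z.1 0 i + z.2 * a 0 i)); last first.
  by apply/funext => z; rewrite !mxE.
apply: measurable_funD.
  by apply: (measurableT_comp (haar_meas i)); exact: measurable_fst.
by apply: measurable_funM => //; exact: measurable_snd.
Qed.

(** Measure the set of pairs (t, s) with [vec t + s *: a] in [E] in two ways. For fixed s the
    section is a translate of the preimage of [E], so its measure does not depend on s, and
    integrating over s gives the infinite factor. Thus [E] is null exactly when almost all its lines
    of direction [a] are null, without any change of coordinates. *)
Lemma haar_fubini :
  (\int[mu]_t lebesgue_measure [set s : R | E (vec t + s *: a)%R] =
   mu (vec @^-1` E) * lebesgue_measure [set: R])%E.
Proof.
have := indic_fubini_tonelli mu lebesgue_measure mA.
rewrite indic_fubini_tonelli_FE// indic_fubini_tonelli_GE//=.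
under eq_integral => t _.
  rewrite (_ : xsection A t = [set s : R | E (vec t + s *: a)]); last first.
    by apply/seteqP; split => s; rewrite /xsection/= inE.
  over.
move=> ->; rewrite -integral_cst//; apply: eq_integral => s _.
have [tau [mtau tauE mutau]] := haar_shift H (s *: a).
rewrite (_ : ysection A s = tau @^-1` (vec @^-1` E)); last first.
  by apply/seteqP; split => t; rewrite /ysection/= inE /A/= tauE.
by apply: mutau; apply: borel_preimage => //; exact: haar_meas.
Qed.

Lemma haar_null_of_lines :
  (forall t, lebesgue_measure [set s : R | E (vec t + s *: a)] = 0%E) ->
  mu (vec @^-1` E) = 0%E.
Proof.
move=> E0; have := haar_fubini.
under eq_integral do rewrite E0.
rewrite integral0 => /esym/eqP; rewrite mule_eq0 => /orP[/eqP//|].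
have -> : lebesgue_measure [set: R] = +oo%E by rewrite -set_itvNyy lebesgue_measure_itv.
by [].
Qed.

Lemma haar_lines_null : mu (vec @^-1` E) = 0%E ->
  {ae mu, forall t, lebesgue_measure [set s : R | E (vec t + s *: a)] = 0%E}.
Proof.
move=> E0; have := haar_fubini; rewrite E0 mul0e => I0.
have mf : measurable_fun setT (fun t => lebesgue_measure [set s : R | E (vec t + s *: a)]).
  have := indic_measurable_fun_fubini_tonelli_F lebesgue_measure mA.
  rewrite indic_fubini_tonelli_FE//; congr measurable_fun.
  apply/funext => t /=; congr lebesgue_measure.
  by apply/seteqP; split => s; rewrite /xsection/= inE.
have := ae_eq_integral_abs mu measurableT mf.
under eq_integral do rewrite gee0_abs//.
rewrite I0 => -[/(_ erefl) ae0 _].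
have Fae := ae_filter_ringOfSetsType mu.
by apply: filterS ae0 => t /(_ I).
Qed.

End haar_lines.

(** * Rademacher's theorem *)

(** The tolerance e can be restricted to the values 1/(j+1). The inner quantifier over i may be
    uncountable, since an intersection of closed sets is closed. *)
Lemma borel_uniform (R : realType) (n : nat) (T : Type) (P : nat -> set T)
    (g : T -> 'rV[R]_n -> R) : (forall k i, P k i -> continuous (g i)) ->
  borel_mx [set x | forall e : R, 0 < e ->
    exists k, forall i, P k i -> `|g i x| <= e].
Proof.
move=> cg; rewrite (_ : mkset _ = \bigcap_j \bigcup_k
    [set x | forall i, P k i -> `|g i x| <= j.+1%:R^-1]); last first.
  apply/seteqP; split => x.
    move=> xP j _; have [|k kP] := xP j.+1%:R^-1; first by rewrite invr_gt0.
    by exists k.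
  move=> xP e e0; have [j _ /(_ j (leqnn j)) je] := near_infty_natSinv_lt (PosNum e0).
  have [k _ kP] := xP j I; exists k => i Pi; apply: le_trans (kP _ Pi) _.
  exact: (ltW je).
rewrite -[X in borel_mx X]setCK setC_bigcap; apply: sigma_algebraC.
apply: sigma_algebra_bigcup => j; apply: sigma_algebraC.
apply: sigma_algebra_bigcup => k.
rewrite -[X in <<s _>> X]setCK; apply: sigma_algebraC; apply: sub_sigma_algebra.
apply: closed_openC.
rewrite (_ : mkset _ = \bigcap_(i in P k)
    ((fun x => `|g i x|) @^-1` [set y | y <= j.+1%:R^-1])); last first.
  by apply/seteqP; split.
apply: closed_bigI => i Pi; apply: closed_comp; last exact: closed_le.
move=> x _; apply: continuous_comp; first exact: (cg k i Pi).
exact: norm_continuous.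
Qed.

(** Two points with the same integer part of s / e are less than e apart, so that integer part is
    injective on [S]. *)
Lemma separated_countable (R : realType) (S : set R) (e : R) : 0 < e ->
  (forall s t, S s -> S t -> s != t -> e <= `|s - t|) -> countable S.
Proof.
move=> e0 sepS.
apply/countable_injP; exists (fun s => pickle (Num.floor (s / e))).
move=> s t /[!inE] Ss St /(pcan_inj (@pickleK _)) st.
apply: contrapT => /eqP /(sepS _ _ Ss St); apply/negP; rewrite -ltNge.
have := floor_itv (s / e); have := floor_itv (t / e); rewrite st.
move=> /andP[t1 t2] /andP[s1 s2]; move: t2 s2; rewrite intrD mulr1z => t2 s2.
have : `|s / e - t / e| < 1 by rewrite ltr_norml; apply/andP; split; lra.
by rewrite -mulrBl normrM normfV (gtr0_norm e0) ltr_pdivrMr// mul1r.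
Qed.

Lemma measurable_line (R : realType) (n : nat) (E : set 'rV[R]_n) x a :
  borel_mx E -> measurable ([set s : R | E (x + s *: a)] : set (measurableTypeR R)).
Proof.
move=> mE; apply: (borel_preimage (f := fun s : measurableTypeR R => x + s *: a)) => // i.
rewrite (_ : (fun _ => _) = (fun s : R => x 0 i + s * a 0 i)); last first.
  by apply/funext => s; rewrite !mxE.
by apply: measurable_funD => //; apply: measurable_funM => //; exact: measurable_id.
Qed.

Section directional.
Variables (R : realType) (n : nat) (f : 'rV[R]_n -> R) (K : R).
Hypothesis K0 : 0 <= K.
Hypothesis lipf : forall x y, `|f x - f y| <= K * `|x - y|.
Implicit Types (a u v x : 'rV[R]_n) (h : R).

Definition quot a x h := (f (x + h *: a) - f x) / h.

(** A Cauchy condition mentions no limit value, so it has the quantifier shape that [borel_uniform]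
    handles. *)
Definition dir_cauchy a := [set x | forall e : R, 0 < e -> exists k : nat,
  forall p : R * R, 0 < `|p.1| < k.+1%:R^-1 /\ 0 < `|p.2| < k.+1%:R^-1 ->
    `|quot a x p.1 - quot a x p.2| <= e].

Definition dir_additive u v := [set x | forall e : R, 0 < e -> exists k : nat,
  forall h, 0 < `|h| < k.+1%:R^-1 ->
    `|quot (u + v) x h - quot u x h - quot v x h| <= e].

Lemma continuous_quot a h : continuous (fun x => quot a x h).
Proof.
apply: (@lipschitz_continuous R _ R^o (2 * K / `|h|)) => x y.
rewrite /quot -mulrBl normrM normfV mulrAC ler_wpM2r ?invr_ge0//.
rewrite opprB addrC -addrA [X in `|X|](_ : _ =
  (f (x + h *: a) - f (y + h *: a)) - (f x - f y)); last by ring.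
apply: le_trans (ler_normB _ _) _; rewrite mulr_natl mulrnAl mulr2n lerD//.
by apply: le_trans (lipf _ _) _; rewrite opprD addrACA subrr addr0.
Qed.

Lemma borel_dir_cauchy a : borel_mx (dir_cauchy a).
Proof.
apply: (@borel_uniform R n (R * R) (fun k => [set p | 0 < `|p.1| < k.+1%:R^-1 /\
   0 < `|p.2| < k.+1%:R^-1]) (fun p x => quot a x p.1 - quot a x p.2)) => k p _ x.
by apply: (@continuousB R R^o _ (fun x => quot a x p.1) (fun x => quot a x p.2));
  exact: continuous_quot.
Qed.

Lemma borel_dir_additive u v : borel_mx (dir_additive u v).
Proof.
apply: (@borel_uniform R n R (fun k => [set h | 0 < `|h| < k.+1%:R^-1])
  (fun h x => quot (u + v) x h - quot u x h - quot v x h)) => k h _ x.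
apply: (@continuousB R R^o _ (fun x => quot (u + v) x h - quot u x h)).
  by apply: (@continuousB R R^o _ (fun x => quot (u + v) x h)); exact: continuous_quot.
exact: continuous_quot.
Qed.

Lemma line_dir_cauchy a x : lebesgue_measure [set s | (~` dir_cauchy a) (x + s *: a)] = 0%E.
Proof.
have /lipschitz_ae_derivable H : forall s t,
    `|f (x + s *: a) - f (x + t *: a)| <= (K * `|a|) * `|s - t|.
  move=> s t; apply: le_trans (lipf _ _) _.
  by rewrite -mulrA ler_wpM2l// opprD addrACA subrr add0r -scalerBl normrZ mulrC.
have {}H := H (mulr_ge0 K0 (normr_ge0 _)).
apply/negligibleP.
  by apply: measurable_line; apply: sigma_algebraC; exact: borel_dir_cauchy.
apply: negligibleS H => s /= Cs D; apply: Cs => e e0.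
move/cvg_ex : D => /= [l /cvgrPdist_le /(_ (e / 2))].
rewrite divr_gt0// => /(_ isT)/nbhs_ballP[d /= d0 dl].
have [k _ /(_ k (leqnn k)) kd] := near_infty_natSinv_lt (PosNum d0).
have {}dl h : 0 < `|h| < k.+1%:R^-1 -> `|l - quot a (x + s *: a) h| <= e / 2.
  move=> /andP[h0 hk]; have := dl h; rewrite /=.
  rewrite /ball/= sub0r normrN => /(_ (lt_trans hk kd)); rewrite -normr_gt0 => /(_ h0).
  suff -> : quot a (x + s *: a) h = h^-1 *: (f (x + (h%:A + s) *: a) - f (x + s *: a)) by [].
  rewrite /quot [RHS]mulrC; congr ((f _ - _) / _).
  by rewrite scalerDl [h%:A]mulr1 addrA addrAC.
exists k => p [/dl p1 /dl p2]; rewrite [e]splitr.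
rewrite (_ : _ - _ = (l - quot a (x + s *: a) p.2) - (l - quot a (x + s *: a) p.1)); last by ring.
by rewrite (le_trans (ler_normB _ _))// lerD.
Qed.

Definition dir_bad u v := (dir_cauchy u `&` dir_cauchy v `&` dir_cauchy (u + v)) `\`
  dir_additive u v.

(* If x + s u and x + t u both belong to the class [S b k j] and |s - t| < 1/k,
   going from x + s u by (t - s) (u + v) through x + t u makes the quotient along
   u + v nearly additive: the points of each class are 1/k-separated. *)
Lemma countable_dir_bad u v x : countable [set s | dir_bad u v (x + s *: u)].
Proof.
(* The factor 10 leaves room: the separation argument below accumulates only a few errors of size
   [e j], against a defect of additivity exceeding [10 * e j]. *)
pose e (j : nat) : R := j.+1%:R^-1 / 10.
pose S (b : rat) (k j : nat) := [set s | let y := x + s *: u in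
  [/\ forall h, 0 < `|h| < k.+1%:R^-1 -> `|quot v y h - ratr b| <= e j,
      forall h h', 0 < `|h| < k.+1%:R^-1 -> 0 < `|h'| < k.+1%:R^-1 ->
        `|quot u y h - quot u y h'| <= e j,
      forall h h', 0 < `|h| < k.+1%:R^-1 -> 0 < `|h'| < k.+1%:R^-1 ->
        `|quot (u + v) y h - quot (u + v) y h'| <= e j &
      exists2 h, 0 < `|h| < k.+1%:R^-1 &
        10 * e j < `|quot (u + v) y h - quot u y h - quot v y h| ]].
have cS b k j : countable (S b k j).
  apply: (@separated_countable _ _ k.+1%:R^-1); first by rewrite invr_gt0.
  move=> s t [Sb Su Suv [h hk hb]] [Tb _ _ _] st.
  rewrite leNgt; apply/negP => stk.
  have h0 : 0 < `|t - s| < k.+1%:R^-1.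
    by rewrite distrC stk normr_gt0 subr_eq0 st.
  have quotD : quot (u + v) (x + s *: u) (t - s) =
      quot v (x + t *: u) (t - s) + quot u (x + s *: u) (t - s).
    rewrite /quot -mulrDl; congr (_ / _).
    have -> : x + s *: u + (t - s) *: (u + v) = x + t *: u + (t - s) *: v.
      by rewrite scalerDr addrA -(addrA x) -scalerDl subrKC.
    have -> : x + s *: u + (t - s) *: u = x + t *: u.
      by rewrite -(addrA x) -scalerDl subrKC.
    by ring.
  have H1 := Tb _ h0; have H2 := Sb _ h0; have H3 := Sb _ hk.
  have H4 := Su _ _ h0 hk; have H5 := Suv _ _ h0 hk.
  move: hb H1 H2 H3 H4 H5; rewrite quotD.
  rewrite !ler_norml ltr_normr => /orP[] hb /andP[a1 b1] /andP[a2 b2]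
    /andP[a3 b3] /andP[a4 b4] /andP[a5 b5]; lra.
have cB : countable (\bigcup_(z in [set: rat * nat * nat]) S z.1.1 z.1.2 z.2).
  by apply: bigcup_countable => //; exact: countableP.
apply: sub_countable cB; apply: subset_card_le => s [[[Cu Cv] Cuv] nA].
have [d /not_implyP[d0 /forallNP nAd]] := (existsNP _).2 nA.
have [j _ /(_ j (leqnn j)) jd] := near_infty_natSinv_lt (PosNum d0).
have ej : 0 < e j by rewrite /e divr_gt0.
(* Along [v] only half the tolerance is used, since the other half pays for replacing a difference
   quotient by the rational [b]. *)
have ej2 : 0 < e j / 2 by rewrite divr_gt0.
have [ku uP] := Cu _ ej; have [kv vP] := Cv _ ej2; have [kuv uvP] := Cuv _ ej.
pose k := maxn ku (maxn kv kuv).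
have kle k' (h : R) : (k' <= k)%N -> 0 < `|h| < k.+1%:R^-1 -> 0 < `|h| < k'.+1%:R^-1.
  move=> k'k /andP[-> hk]/=; apply: lt_le_trans hk _.
  by rewrite lef_pV2 ?posrE// ler_nat ltnS.
have kuk : (ku <= k)%N by rewrite leq_maxl.
have kvk : (kv <= k)%N by rewrite leq_max leq_maxl orbT.
have kuvk : (kuv <= k)%N by rewrite !leq_max leqnn !orbT.
pose h0 : R := k.+1%:R^-1 / 2.
have h0k : 0 < `|h0| < k.+1%:R^-1.
  have k0 : 0 < k.+1%:R^-1 :> R by rewrite invr_gt0.
  by rewrite gtr0_norm /h0 ?divr_gt0//= ltr_pdivrMr// ltr_pMr// ltr1n.
have [b] := @rat_in_itvoo R (quot v (x + s *: u) h0 - e j / 2)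
  (quot v (x + s *: u) h0 + e j / 2) ltac:(lra).
rewrite in_itv/= => /andP[b1 b2].
exists (b, k, j) => //; split => /=.
- move=> h hk; have := vP (h, h0) (conj (kle _ _ kvk hk) (kle _ _ kvk h0k)).
  rewrite /= !ler_norml => /andP[c1 c2]; apply/andP; split; lra.
- by move=> h h' hk h'k; apply: (uP (h, h')); split; exact: kle.
- by move=> h h' hk h'k; apply: (uvP (h, h')); split; exact: kle.
- have [h /not_implyP[hk /negP]] := (existsNP _).2 (nAd k).
  rewrite -ltNge => hd; exists h => //; apply: le_lt_trans hd.
  by rewrite /e mulrC divfK//; exact: ltW.
Qed.

Definition has_dir x a (l : R) := forall e : R, 0 < e -> exists k : nat,
  forall h, 0 < `|h| < k.+1%:R^-1 -> `|quot a x h - l| <= e.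

Lemma half_inv_lt (k : nat) : 0 < `|k.+1%:R^-1 / 2 : R| < k.+1%:R^-1.
Proof.
have k0 : 0 < k.+1%:R^-1 :> R by rewrite invr_gt0.
by rewrite gtr0_norm ?divr_gt0//= ltr_pdivrMr// ltr_pMr// ltr1n.
Qed.

Lemma dir_cauchy_has_dir x a : dir_cauchy a x -> exists l, has_dir x a l.
Proof.
move=> Ca.
have cF : cauchy (quot a x @ (0 : R)^').
  apply: cauchy_exP => e e0.
  have [k kP] := Ca _ (divr_gt0 e0 (ltr0n _ 2)).
  exists (quot a x (k.+1%:R^-1 / 2)); apply/nbhs_ballP.
  exists k.+1%:R^-1 => /=; first by rewrite invr_gt0.
  move=> h; rewrite /ball/= sub0r normrN => hk h0.
  have {}hk : 0 < `|h| < k.+1%:R^-1 by rewrite normr_gt0 h0.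
  rewrite /ball/=; apply: le_lt_trans (kP (_, h) (conj (half_inv_lt k) hk)) _.
  by rewrite ltr_pdivrMr// ltr_pMr// ltr1n.
have /cauchy_cvgP/cvg_ex[l lP] := cF.
exists l => e e0; move/cvgrPdist_le : lP => /(_ _ e0) /nbhs_ballP[d /= d0 dP].
have [k _ /(_ k (leqnn k)) kd] := near_infty_natSinv_lt (PosNum d0).
exists k => h /andP[h0 hk]; rewrite distrC; apply: dP => /=.
  by rewrite /ball/= sub0r normrN (lt_trans hk).
by rewrite -normr_gt0.
Qed.

Lemma has_dirD x u v l m : has_dir x u l -> has_dir x v m -> dir_additive u v x ->
  has_dir x (u + v) (l + m).
Proof.
move=> ul vm uv e e0.
have e3 : 0 < e / 3 by rewrite divr_gt0.
have [k1 k1P] := ul _ e3; have [k2 k2P] := vm _ e3; have [k3 k3P] := uv _ e3.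
exists (maxn k1 (maxn k2 k3)) => h /andP[h0 hk].
have kle k' : (k' <= maxn k1 (maxn k2 k3))%N -> 0 < `|h| < k'.+1%:R^-1.
  move=> k'k; rewrite h0/=; apply: lt_le_trans hk _.
  by rewrite lef_pV2 ?posrE// ler_nat ltnS.
have := k1P h (kle _ _); have := k2P h (kle _ _); have := k3P h (kle _ _).
rewrite !leq_max !leqnn !orbT => /(_ erefl) + /(_ erefl) + /(_ erefl).
rewrite !ler_norml => /andP[? ?] /andP[? ?] /andP[? ?]; apply/andP; split; lra.
Qed.

Lemma has_dir0 x : has_dir x 0 0.
Proof.
by move=> e e0; exists 0%N => h _; rewrite /quot scaler0 addr0 subrr mul0r subr0 normr0 ltW.
Qed.

Lemma has_dirZ x u l c : has_dir x u l -> has_dir x (c *: u) (c * l).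
Proof.
move=> ul; have [->|c0] := eqVneq c 0; first by rewrite scale0r mul0r; exact: has_dir0.
have nc0 : 0 < `|c| by rewrite normr_gt0.
move=> e e0; have [k kP] := ul _ (divr_gt0 e0 nc0).
have d0 : 0 < k.+1%:R^-1 / `|c| by rewrite divr_gt0.
have [k' _ /(_ k' (leqnn k')) kd] := near_infty_natSinv_lt (PosNum d0).
exists k' => h /andP[h0 hk].
have : 0 < `|h * c| < k.+1%:R^-1.
  rewrite normrM mulr_gt0//= -ltr_pdivlMr//; exact: lt_trans kd.
move=> /kP; rewrite ler_pdivlMr// -normrM; congr (`|_| <= _).
have hn0 : h != 0 by rewrite -normr_gt0.
by rewrite /quot scalerA; field; rewrite hn0 c0.
Qed.

(** Additivity makes the derivatives along rational directions values of one linear form [g]. The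
    direction w / |w| is then approximated by one of finitely many rational grid directions.
    Finiteness makes the convergence of the quotients uniform, and the Lipschitz property absorbs
    the approximation error. *)
Lemma rademacher_point x :
  (forall c : 'rV[rat]_n, dir_cauchy (map_mx ratr c) x) ->
  (forall c c' : 'rV[rat]_n, dir_additive (map_mx ratr c) (map_mx ratr c') x) ->
  exists g : 'I_n -> R, forall e, 0 < e -> exists2 d, 0 < d & forall w, `|w| < d ->
    `|f (x + w) - f x - \sum_i w 0 i * g i| <= e * `|w|.
Proof.
move=> xC xA.
have gex (i : 'I_n) : exists l, has_dir x (delta_mx 0 i) l.
  by apply: dir_cauchy_has_dir; have := xC (delta_mx 0 i); rewrite map_delta_mx.
have [g gP] := choice gex.
have cg (c : 'rV[rat]_n) : has_dir x (map_mx ratr c) (\sum_i ratr (c 0 i) * g i).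
  rewrite {1}[c]row_sum_delta.
  elim: (index_enum _) => [|i t IH].
    by rewrite !big_nil map_mx0; exact: has_dir0.
  rewrite !big_cons map_mxD; apply: has_dirD => //.
  by rewrite map_mxZ map_delta_mx; exact/has_dirZ/gP.
exists g => e e0.
pose G := K + \sum_i `|g i|.
have G0 : 0 <= G by rewrite addr_ge0// sumr_ge0.
have e20 : 0 < e / 2 by rewrite divr_gt0.
(* A mesh 1/(M+1) costs at most [K] / (M+1) for [f] and the sum of the |g i| over M+1 for the linear
   form, both relative to |w|. Their sum [G] / (M+1) may use half of e. *)
pose M := Num.bound (G / (e / 2)).
have M0 : 0 < M.+1%:R :> R by [].
have GM : G / M.+1%:R <= e / 2.
  rewrite ler_pdivrMr// mulrC -ler_pdivrMr//.
  apply: ltW; apply: lt_trans (archi_boundP _) _; last by rewrite ltr_nat.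
  by rewrite divr_ge0// ltW.
(* The grid of mesh 1/(M+1) in the cube [-1, 1]^n; indices run from 0 to 2(M+1) and are shifted by
   M+1. *)
pose D (c : {ffun 'I_n -> 'I_(M.+1.*2).+1}) : 'rV[rat]_n :=
  \row_i (((c i)%:R - M.+1%:R) / M.+1%:R).
have [k kP] := choice (fun c => cg (D c) _ e20).
pose k0 := (\max_c k c)%N.
exists k0.+1%:R^-1; first by rewrite invr_gt0.
move=> w wk.
have [->|w0] := eqVneq w 0.
  by rewrite addr0 subrr sub0r normrN big1 ?normr0 ?mulr0// => i _; rewrite mxE mul0r.
have nw0 : 0 < `|w| by rewrite normr_gt0.
pose a i : R := w 0 i / `|w| * M.+1%:R.
have ale i : - M.+1%:R <= a i <= M.+1%:R.
  rewrite -ler_norml /a !normrM normfV normr_id (gtr0_norm M0) ler_piMl//.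
  by rewrite ler_pdivrMr// mul1r mx_norm_ge.
have [c ca] : exists c : {ffun 'I_n -> 'I_(M.+1.*2).+1},
    forall i, `|ratr (D c 0 i) - w 0 i / `|w| | <= M.+1%:R^-1.
  have normM (y : R) : `|y| * M.+1%:R = `|y * M.+1%:R| by rewrite normrM (gtr0_norm M0).
  have cex i : exists j : 'I_(M.+1.*2).+1, `|a i + M.+1%:R - j%:R| <= 1.
    have [a1 a2] := andP (ale i).
    have b0 : 0 <= a i + M.+1%:R by rewrite -lerBlDr sub0r.
    have /andP[t1 t2] := truncn_itv b0.
    have tM : (Num.truncn (a i + M.+1%:R) < (M.+1.*2).+1)%N.
      rewrite ltnS -(ler_nat R); apply: le_trans t1 _.
      by rewrite -addnn natrD lerD2r.
    exists (Ordinal tM) => /=; rewrite ler_norml; move: t2; rewrite -[ltRHS]natr1 => t2.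
    by apply/andP; split; lra.
  have [c cP] := choice cex.
  exists [ffun i => c i] => i; rewrite /D mxE ffunE.
  rewrite rmorphM rmorphB fmorphV /= !ratr_nat.
  rewrite -[leRHS]mul1r ler_pdivlMr// normM.
  apply: le_trans (cP i); rewrite distrC le_eqVlt; apply/orP; left; apply/eqP.
  by congr (`|_|); rewrite /a; field; rewrite gt_eqF// gt_eqF.
have h1 : 0 < `| `|w| | < (k c).+1%:R^-1.
  rewrite normr_id nw0/=; apply: lt_le_trans wk _.
  by rewrite lef_pV2 ?posrE// ler_nat ltnS; exact: (@leq_bigmax _ k c).
have := kP c _ h1; rewrite /quot.
set d' := map_mx ratr (D c) => H1.
have cw i : `| `|w| * ratr (D c 0 i) - w 0 i| <= `|w| / M.+1%:R.
  rewrite (_ : _ - _ = `|w| * (ratr (D c 0 i) - w 0 i / `|w|)).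
    by rewrite normrM normr_id ler_pM2l.
  by field; rewrite gt_eqF.
have H2 : `|f (x + w) - f (x + `|w| *: d')| <= K * (`|w| / M.+1%:R).
  apply: le_trans (lipf _ _) _; rewrite ler_wpM2l//.
  rewrite opprD addrACA subrr add0r.
  apply: mx_norm_le => [|i]; first by rewrite divr_ge0.
  apply: le_trans (cw i); rewrite distrC.
  suff -> : (w - `|w| *: d') 0 i = w 0 i - `|w| * ratr (D c 0 i) by [].
  by rewrite !mxE.
have H3 : `|\sum_i (`|w| * ratr (D c 0 i)) * g i - \sum_i w 0 i * g i| <=
    `|w| / M.+1%:R * \sum_i `|g i|.
  rewrite -sumrB; apply: le_trans (ler_norm_sum _ _ _) _.
  rewrite mulr_sumr; apply: ler_sum => i _.
  by rewrite -mulrBl normrM ler_wpM2r.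
have H4 : `|f (x + `|w| *: d') - f x - \sum_i (`|w| * ratr (D c 0 i)) * g i| <= e / 2 * `|w|.
  have normW (y : R) : `|y| * `|w| = `|y * `|w| | by rewrite normrM normr_id.
  move: H1; rewrite -(ler_pM2r nw0) normW mulrBl divfK ?gt_eqF//.
  congr (`|_ - _| <= _); rewrite mulr_suml; apply: eq_bigr => i _; ring.
rewrite (_ : _ - _ - _ = (f (x + w) - f (x + `|w| *: d')) +
  (f (x + `|w| *: d') - f x - \sum_i (`|w| * ratr (D c 0 i)) * g i) +
  (\sum_i (`|w| * ratr (D c 0 i)) * g i - \sum_i w 0 i * g i)); last by ring.
apply: le_trans (ler_normD _ _) _; apply: le_trans (lerD (ler_normD _ _) (lexx _)) _.
apply: le_trans (lerD (lerD H2 H4) H3) _.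
have : G / M.+1%:R * `|w| <= e / 2 * `|w| by rewrite ler_wpM2r.
rewrite /G => H5.
rewrite [leRHS](_ : _ = e / 2 * `|w| + e / 2 * `|w|); last by rewrite -mulrDl -splitr.
rewrite addrAC lerD2r; apply: le_trans H5.
by rewrite mulrDl mulrDl lerD// le_eqVlt; apply/orP; left; apply/eqP; ring.
Qed.

End directional.

Lemma mulmx_rV_continuous (R : realType) (n m : nat) (M : 'M[R]_(n, m)) :
  continuous (fun w : 'rV[R]_n => w *m M).
Proof.
pose B := \sum_(j < m) \sum_(i < n) `|M i j|.
have B0 : 0 <= B by do 2 (apply: sumr_ge0 => ? _).
apply: (@lipschitz_continuous R _ _ B) => x y.
rewrite -mulmxBl; apply: mx_norm_le; first by rewrite mulr_ge0.
move=> j; rewrite mxE /B (bigD1 j)//= mulrDl.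
rewrite -[leLHS]addr0 lerD//; last first.
  by rewrite mulr_ge0// sumr_ge0// => k _; rewrite sumr_ge0.
apply: le_trans (ler_norm_sum _ _ _) _; rewrite mulr_suml; apply: ler_sum => i _.
by rewrite normrM mulrC ler_wpM2l// mx_norm_ge.
Qed.

Lemma differentiable_of_linear (R : realType) (V W : normedModType R) (F : V -> W)
    (x : V) (L : {linear V -> W}) : continuous L ->
  (forall e : R, 0 < e -> exists2 d, 0 < d & forall w, `|w| < d ->
    `|F (x + w) - F x - L w| <= e * `|w|) ->
  differentiable F x.
Proof.
move=> cL FL.
have FxL : F \o shift x = cst (F x) + L +o_ 0 id.
  apply/eqaddoP => e e0; have [d d0 dP] := FL _ e0.
  apply/nbhs_ballP; exists d => //= w; rewrite -ball_normE /ball_/= sub0r normrN => /dP.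
  by rewrite -addrA -opprD (addrC x).
by apply/diff_locallyP; rewrite (diff_unique cL FxL).
Qed.

Section rademacher.
Variables (R : realType) (n m : nat) (H : haar_space R n).
Variables (F : 'rV[R]_n -> 'rV[R]_m) (K : R).
Hypothesis K0 : 0 <= K.
Hypothesis lipF : forall x y, `|F x - F y| <= K * `|x - y|.

Let lipi i x y : `|F x 0 i - F y 0 i| <= K * `|x - y|.
Proof. by apply: le_trans (lipF x y); have := mx_norm_ge (F x - F y) i; rewrite !mxE. Qed.

Let B (z : 'I_m * 'rV[rat]_n * 'rV[rat]_n) : set 'rV[R]_n :=
  ~` dir_cauchy (fun x => F x 0 z.1.1) (map_mx ratr z.1.2) `|`
  dir_bad (fun x => F x 0 z.1.1) (map_mx ratr z.1.2) (map_mx ratr z.2).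

Lemma borelU (A C : set 'rV[R]_n) : borel_mx A -> borel_mx C -> borel_mx (A `|` C).
Proof.
move=> mA mC; rewrite -bigcup2E; apply: sigma_algebra_bigcup => -[|[|k]] //=.
exact: sigma_algebra0.
Qed.

Lemma borel_dir_bad (f : 'rV[R]_n -> R) u v :
  (forall x y, `|f x - f y| <= K * `|x - y|) -> borel_mx (dir_bad f u v).
Proof.
move=> lipf; rewrite -[X in borel_mx X]setCK; apply: sigma_algebraC.
rewrite /dir_bad setDE !setCI !setCK.
by do !apply: borelU; do ?apply: sigma_algebraC;
  (exact: (borel_dir_cauchy lipf)) || (exact: (borel_dir_additive lipf)).
Qed.

Let mB z : borel_mx (B z).
Proof.
apply: borelU; last exact: borel_dir_bad.
apply: sigma_algebraC; exact: (borel_dir_cauchy (lipi _)).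
Qed.

(** Both parts of [B z] are tested on lines of the single direction [z.1.2]: the first meets them in
    a null set by one-variable differentiability, the second in a countable set. *)
Let muB z : haar_mu H (@haar_vec _ _ H @^-1` B z) = 0%E.
Proof.
have bc := borel_preimage (@haar_meas _ _ H).
rewrite /B preimage_setU; apply/negligibleP.
  apply: measurableU; apply: bc; last exact: borel_dir_bad.
  by apply: sigma_algebraC; exact: (borel_dir_cauchy (lipi _)).
apply: negligibleU; apply/negligibleP.
- by apply: bc; apply: sigma_algebraC; exact: (borel_dir_cauchy (lipi _)).
- apply: (@haar_null_of_lines _ _ _ (map_mx ratr z.1.2)) => [|t].
    by apply: sigma_algebraC; exact: (borel_dir_cauchy (lipi _)).
  exact: (line_dir_cauchy K0 (lipi _)).
- by apply: bc; exact: borel_dir_bad.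
- apply: (@haar_null_of_lines _ _ _ (map_mx ratr z.1.2)) => [|t].
    exact: borel_dir_bad.
  by apply: countable_lebesgue_measure0; exact: countable_dir_bad.
Qed.

(** A countable union over coordinates and pairs of rational directions. The exceptional set is
    returned as a Borel set so that [haar_lines_null] can later cut it by lines of arbitrary
    direction. *)
Lemma rademacher : exists N : set 'rV[R]_n, [/\ borel_mx N,
  haar_mu H (@haar_vec _ _ H @^-1` N) = 0%E &
  forall x, ~ N x -> differentiable F x].
Proof.
pose B' k := if unpickle k is Some z then B z else set0.
have mB' k : borel_mx (B' k).
  by rewrite /B'; case: unpickle => [z|]; [exact: mB|exact: sigma_algebra0].
exists (\bigcup_k B' k); split.
- exact: sigma_algebra_bigcup.
- rewrite preimage_bigcup; apply/negligibleP.
    apply: bigcup_measurable => k _.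
    exact: (borel_preimage (@haar_meas _ _ H)).
  apply: negligible_bigcup => k; apply/negligibleP.
    exact: (borel_preimage (@haar_meas _ _ H)).
  by rewrite /B'; case: unpickle => [z|]; [exact: muB|rewrite preimage_set0 measure0].
move=> x xB.
have xBz z : ~ B z x.
  by move=> Bzx; apply: xB; exists (pickle z) => //; rewrite /B' pickleK.
have gi i : exists g : 'I_n -> R, forall e, 0 < e -> exists2 d, 0 < d &
    forall w, `|w| < d ->
    `|F (x + w) 0 i - F x 0 i - \sum_j w 0 j * g j| <= e * `|w|.
  have xC c : dir_cauchy (fun x => F x 0 i) (map_mx ratr c) x.
    by have /not_orP[/contrapT] := xBz (i, c, c).
  apply: (rademacher_point K0 (lipi i)) => // c c'.
  have /not_orP[_ ] := xBz (i, c, c'); rewrite /dir_bad/= => nb.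
  apply: contrapT => nA; apply: nb; split => //; split => //.
  by rewrite -map_mxD; exact: xC.
have [g gP] := choice gi.
apply: (@differentiable_of_linear R _ _ F x (mulmxr (\matrix_(j, i) g i j))) => [|e e0].
  exact: mulmx_rV_continuous.
have di i : exists d, 0 < d /\ forall w, `|w| < d ->
    `|F (x + w) 0 i - F x 0 i - \sum_j w 0 j * g i j| <= e * `|w|.
  by have [d d0 dP] := gP i _ e0; exists d.
have [d dP] := choice di.
exists (\big[Num.min/1]_i d i).
  by apply/bigmin_gtP; split => // i _; have [] := dP i.
move=> w /bigmin_gtP[_ wd].
apply: mx_norm_le => [|i]; first by rewrite mulr_ge0// ltW.
have [_ /(_ w (wd i isT))] := dP i.
rewrite !mxE; congr (`|_ - _| <= _).
by apply: eq_bigr => j _; rewrite mxE.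
Qed.

End rademacher.

(** * The Clarke Jacobian *)

Lemma near_eq_differentiable (R : realType) (V W : normedModType R) (f g : V -> W)
    (x : V) : {near x, f =1 g} -> differentiable f x -> differentiable g x.
Proof.
move=> fg df; apply: (@differentiable_of_linear _ _ _ g x ('d f x)) => [|e e0].
  exact: diff_continuous.
have /eqaddoP /(_ e e0) /nbhs_ballP[d /= d0 dP] := diff_locally df.
have /nbhs_ballP[d' /= d'0 d'P] := fg.
exists (Num.min d d') => [|w]; first by rewrite lt_min d0.
rewrite lt_min => /andP[wd wd'].
rewrite -!d'P; first last.
- by rewrite -ball_normE /ball_/= opprD addrA subrr sub0r normrN.
- exact: ballxx.
have := dP w; rewrite -ball_normE /ball_/= sub0r normrN => /(_ wd).
by rewrite -addrA -opprD (addrC x).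
Qed.

Lemma continuous_dot (R : realType) (m : nat) (q : 'rV[R]_m) :
  continuous (fun w : 'rV[R]_m => dot q w : R^o).
Proof.
apply: (@lipschitz_continuous R _ R^o (enorm q * m%:R)) => w z.
rewrite -dotBr; apply: le_trans (cauchy_schwarz _ _) _.
by rewrite -mulrA ler_wpM2l ?enorm_ge0// mx_norm_enorm.
Qed.

Lemma cvg_dot_derive (R : realType) (n m : nat) (F : 'rV[R]_n -> 'rV[R]_m) x d q :
  differentiable F x ->
  dot q (h^-1 *: ((F \o shift x) (h *: d) - F x)) @[h --> (0 : R)^'] -->
    (dot q ('D_d F x) : R^o).
Proof.
move=> DF; have dF : derivable F x d by exact: diff_derivable.
exact: (cvg_comp _ _ dF (@continuous_dot R m q _)).
Qed.

Section mean_value.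
Variables (R : realType) (n m : nat).
Variables (F : 'rV[R]_n -> 'rV[R]_m) (K : R).
Hypothesis K0 : 0 <= K.
Hypothesis lipF : forall x y, `|F x - F y| <= K * `|x - y|.
Variables (q : 'rV[R]_m) (d : 'rV[R]_n).

Let C := enorm q * (m%:R * K).

Let C0 : 0 <= C.
Proof. by rewrite !mulr_ge0// enorm_ge0. Qed.

Let dot_lip x y : `|dot q (F x - F y)| <= C * `|x - y|.
Proof.
apply: le_trans (cauchy_schwarz _ _) _; rewrite /C -mulrA ler_wpM2l ?enorm_ge0//.
apply: le_trans (mx_norm_enorm _) _; rewrite -mulrA ler_wpM2l//.
Qed.

Let phi (x : 'rV[R]_n) (s : R) := dot q (F (x + s *: d)).

Let phi_lip x s t : `|phi x s - phi x t| <= (C * `|d|) * `|s - t|.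
Proof.
rewrite /phi -dotBr; apply: le_trans (dot_lip _ _) _.
by rewrite opprD addrACA subrr add0r -scalerBl normrZ (mulrC `|s - t|) mulrA.
Qed.

Let phi_derive x s : differentiable F (x + s *: d) ->
  derive1 (phi x) s = dot q ('D_d F (x + s *: d)).
Proof.
move=> dF; rewrite derive1E; apply/cvg_lim => //.
rewrite (_ : (fun h => _) = (fun h : R =>
  dot q (h^-1 *: ((F \o shift (x + s *: d)) (h *: d) - F (x + s *: d))))); last first.
  apply/funext => h; rewrite /= dotZr dotBr; congr (_ * (dot q (F _) - _)).
  by rewrite scalerDl [h%:A]mulr1 addrCA.
exact: cvg_dot_derive.
Qed.

(** The segment issuing from [x0] may lie inside the exceptional set. It is shifted to start at a
    point within e of [x0] whose line meets that set in a null set; the one-variable estimate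
    applies there and the shift costs 2 C e. The strict bound s |d| < r leaves room for the
    shift. *)
Lemma mean_value_lipschitz x0 (r c : R) :
  (forall y, `|x0 - y| < r -> differentiable F y -> dot q ('D_d F y) <= c) ->
  forall s, 0 <= s -> s * `|d| < r -> dot q (F (x0 + s *: d) - F x0) <= c * s.
Proof.
move=> Fc s s0 sr.
pose H := haar R n.
have [N [mN muN dN]] := rademacher H K0 lipF.
have Nae := @haar_lines_null R n H d N mN muN.
suff He e : 0 < e -> e < r - s * `|d| ->
    dot q (F (x0 + s *: d) - F x0) <= c * s + 2 * C * e.
  apply/ler_addgt0Pr => e e0.
  (* For [C = 0] the choice e / (2 C) made below would be 0, which is not an admissible shift. *)
  have [C00|Cneq0] := eqVneq C 0.
    pose e' := (r - s * `|d|) / 2.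
    have e'0 : 0 < e' by rewrite divr_gt0// subr_gt0.
    have e'r : e' < r - s * `|d| by rewrite /e' ltr_pdivrMr// ltr_pMr ?ltr1n// subr_gt0.
    have := He _ e'0 e'r; rewrite C00 mulr0 mul0r addr0 => /le_trans; apply.
    by rewrite lerDl ltW.
  have Cp : 0 < 2 * C by rewrite mulr_gt0// lt_neqAle eq_sym Cneq0.
  pose e' := Num.min (e / (2 * C)) ((r - s * `|d|) / 2).
  have e'0 : 0 < e' by rewrite lt_min !divr_gt0// subr_gt0.
  have e'r : e' < r - s * `|d|.
    rewrite gt_min; apply/orP; right.
    by rewrite ltr_pdivrMr// ltr_pMr ?ltr1n// subr_gt0.
  apply: le_trans (He _ e'0 e'r) _; rewrite lerD2l -ler_pdivlMl// mulrC.
  by rewrite ge_min lexx.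
move=> e0 er.
(* The ball of radius e around [x0] has positive measure, whereas the bad starting points form a
   null set. *)
have [t [xt tN]] : exists t : haar_type H, `|x0 - haar_vec t| < e /\
    lebesgue_measure [set s' : R | N (haar_vec t + s' *: d)] = 0%E :> \bar R.
  apply: contrapT => /forallNP tP.
  have := haar_pos H x0 e0; apply/negP; rewrite -leNgt measure_le0.
  have sub : [set t : haar_type H | forall i, `|x0 0 i - haar_vec t 0 i| < e] `<=`
      [set t : haar_type H |
        ~ (lebesgue_measure [set s' : R | N (haar_vec t + s' *: d)] = 0%E :> \bar R)].
    move=> t te; have := tP t => /not_andP[xt|//]; exfalso; apply: xt.
    by rewrite mx_norm_lt//; apply/forallP => i; have := te i; rewrite !mxE.
  apply/eqP; apply/negligibleP; last exact: negligibleS sub Nae.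
  rewrite (_ : mkset _ = @haar_vec _ _ H @^-1` ball x0 e).
    by apply: (borel_preimage (@haar_meas _ _ H)); apply: sub_sigma_algebra; exact: ball_open.
  apply/seteqP; split => t /=; rewrite mx_norm_ball /ball_/= mx_norm_lt//.
    by move=> tb; apply/forallP => i; have := tb i; rewrite !mxE.
  by move=> /forallP tb i; have := tb i; rewrite !mxE.
set y := haar_vec t in xt tN.
have phi_le : phi y s - phi y 0 <= c * (s - 0).
  apply: (@lipschitz_derive_le _ _ (C * `|d|)) => //.
    by rewrite mulr_ge0.
  have tN' : (@lebesgue_measure R).-negligible [set s' : R | N (y + s' *: d)].
    apply/negligibleP; last exact: tN.
    exact: measurable_line.
  apply: negligibleS tN' => s' /= ns'; apply: contrapT => Ny; apply: ns' => /andP[s'0 s's] _.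
  rewrite phi_derive; last exact: dN.
  apply: Fc; last exact: dN.
  rewrite opprD addrA; apply: le_lt_trans (ler_normB _ _) _.
  rewrite normrZ (gtr0_norm s'0); apply: (@le_lt_trans _ _ (e + s * `|d|)).
    by rewrite lerD ?ler_wpM2r// ltW.
  by rewrite -ltrBrDr.
move: phi_le; rewrite /phi scale0r addr0 subr0 -dotBr => phi_le.
have H1 := dot_lip (x0 + s *: d) (y + s *: d).
have H2 := dot_lip y x0.
move: H1; rewrite opprD addrACA subrr addr0 => H1.
have E : F (x0 + s *: d) - F x0 = (F (x0 + s *: d) - F (y + s *: d)) +
  (F (y + s *: d) - F y) + (F y - F x0).
  by rewrite subrKA subrKA.
rewrite E !dotDr.
have {}H1 := le_trans (ler_norm _) H1.
have {}H2 := le_trans (ler_norm _) H2.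
have H3 : C * `|x0 - y| <= C * e by rewrite ler_wpM2l// ltW.
move: H2; rewrite distrC => H2; move: phi_le H1 H2; rewrite !dotBr !dotNr; lra.
Qed.

End mean_value.

Lemma dot_mulmx (R : realType) (m n : nat) (q : 'rV[R]_m) (A : 'M[R]_(m, n)) d :
  dot (q *m A) d = dot q (d *m A^T).
Proof.
rewrite /dot; under eq_bigr do rewrite mxE big_distrl/=.
rewrite exchange_big/=; apply: eq_bigr => j _.
rewrite mxE big_distrr/=; apply: eq_bigr => i _.
by rewrite !mxE -mulrA (mulrC (A j i)).
Qed.

Lemma dot_mulmx_le (R : realType) (m n : nat) (q : 'rV[R]_m) (M : 'M[R]_(m, n)) d :
  `|dot (q *m M) d| <= n%:R * m%:R * `|q| * `|d| * `|M|.
Proof.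
have Mij i j : `|M i j| <= `|M|.
  by rewrite [leRHS]/Num.norm/= mx_normrE; apply: (le_bigmax _ _ (i, j)).
apply: le_trans (ler_norm_sum _ _ _) _.
apply: (@le_trans _ _ (\sum_(j < n) (m%:R * `|q| * `|d| * `|M|))); last first.
  by rewrite sumr_const card_ord -[leLHS]mulr_natl !mulrA.
apply: ler_sum => j _; rewrite normrM mxE.
apply: (@le_trans _ _ ((\sum_(i < m) `|q| * `|M|) * `|d|)).
  apply: ler_pM => //; last exact: mx_norm_ge.
  apply: le_trans (ler_norm_sum _ _ _) _; apply: ler_sum => i _.
  by rewrite normrM ler_pM// mx_norm_ge.
by rewrite sumr_const card_ord -[X in X * _]mulr_natl -!mulrA (mulrC `|d|).
Qed.

(** Compactness of a box, transported through [mxvec]. The indices found need not increase with k,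
    but they are at least k, which is enough for convergence along them. *)
Lemma bounded_mx_cluster (R : realType) (m n : nat) (J : nat -> 'M[R]_(m, n)) (B : R) :
  (forall k i j, `|J k i j| <= B) ->
  exists A : 'M[R]_(m, n), forall k, exists i, (k <= i)%N /\ `|A - J i| < k.+1%:R^-1.
Proof.
move=> JB.
pose S := [set v : 'rV[R]_(m * n) | forall i, `[- B, B]%classic (v 0 i)].
have cS : compact S.
  by apply: (@rV_compact R _ (fun=> `[- B, B]%classic)) => i; exact: segment_compact.
have FS : (mxvec \o J @ \oo) S.
  exists 0%N => // k _ i; case: (mxvec_indexP i) => a b.
  by rewrite /= in_itv/= mxvecE -ler_norml.
have [a [_ ca]] := cS _ (fmap_proper_filter _ _) FS.
exists (vec_mx a) => k.
have e0 : 0 < k.+1%:R^-1 :> R by rewrite invr_gt0.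
have [v [[i ki <-] av]] := ca [set mxvec (J i) | i in [set i | (k <= i)%N]]
  (ball a k.+1%:R^-1) (@filterS _ _ _ _ _ (fun i ki => ex_intro2 _ _ i ki erefl)
    (nbhs_infty_ge k)) (nbhsx_ballx a _ e0).
exists i; split => //.
rewrite [ltLHS]/Num.norm/= mx_normrE; apply/bigmax_ltP; split => // -[b c] _ /=.
move: av; rewrite mx_norm_ball /ball_/= mx_norm_lt// => /forallP/(_ (mxvec_index b c)).
by rewrite !mxE mxvecE.
Qed.

Section clarke.
Variables (R : realType) (n m : nat) (Theta : 'rV[R]_n -> 'rV[R]_m).
Variables (tau : R) (O : set 'rV[R]_n).
Hypothesis tau0 : 0 <= tau.
Hypothesis oO : open O.
Hypothesis lipT : elipschitz tau O Theta.
Variable x0 : 'rV[R]_n.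
Hypothesis Ox0 : O x0.

(** [Theta] is Lipschitz only on [O]. Composing it with the coordinatewise clamp onto a small cube
    around [x0] gives a globally Lipschitz map that agrees with [Theta] inside the cube, so
    derivatives there coincide. *)
Lemma mean_value_local : exists2 rho : R, 0 < rho & forall q d r c, r <= rho ->
  (forall y, `|x0 - y| < r -> differentiable Theta y ->
     dot q ('D_d Theta y) <= c) ->
  forall s, 0 <= s -> s * `|d| < r -> dot q (Theta (x0 + s *: d) - Theta x0) <= c * s.
Proof.
have /nbhs_ballP[e /= e0 eO] : nbhs x0 O by exact: open_nbhs_nbhs.
pose rho := e / 2; have rho0 : 0 < rho by rewrite divr_gt0.
have rhoe : rho < e by rewrite ltr_pdivrMr// ltr_pMr// ltr1n.
pose cl1 (a : R) := clamp (a - rho) (a + rho).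
have cl1_lip a s t : `|cl1 a s - cl1 a t| <= `|s - t|.
  by apply: clamp_lipschitz; lra.
have cl1_near a t : `|a - cl1 a t| <= rho.
  rewrite ler_norml /cl1 /clamp !maxEle !minEle.
  by do !case: ifPn; rewrite -?ltNge => *; apply/andP; split; lra.
have cl1_id a t : `|a - t| < rho -> cl1 a t = t.
  rewrite ltr_norml /cl1 /clamp !maxEle !minEle => /andP[].
  by do !case: ifPn; rewrite -?ltNge => *; lra.
pose cl (y : 'rV[R]_n) : 'rV[R]_n := \row_i cl1 (x0 0 i) (y 0 i).
have clO y : O (cl y).
  apply: eO; rewrite -ball_normE /ball_/=; apply: le_lt_trans rhoe.
  by apply: mx_norm_le => [|i]; [exact: ltW|rewrite !mxE].
have cl_lip x y : `|cl x - cl y| <= `|x - y|.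
  apply: mx_norm_le => // i; rewrite !mxE; apply: le_trans (cl1_lip _ _ _) _.
  by have := mx_norm_ge (x - y) i; rewrite !mxE.
have cl_id y : `|x0 - y| < rho -> cl y = y.
  move=> xy; apply/rowP => i; rewrite mxE cl1_id//.
  by apply: le_lt_trans xy; have := mx_norm_ge (x0 - y) i; rewrite !mxE.
pose F := Theta \o cl.
have lipF x y : `|F x - F y| <= (tau * n%:R) * `|x - y|.
  apply: le_trans (enorm_mx_norm _) _; apply: le_trans (lipT (clO _) (clO _)) _.
  rewrite -mulrA ler_wpM2l//; apply: le_trans (mx_norm_enorm _) _.
  by rewrite ler_wpM2l.
have nearF y : `|x0 - y| < rho -> {near y, F =1 Theta}.
  move=> xy; apply/nbhs_ballP; exists (rho - `|x0 - y|) => /=; first by rewrite subr_gt0.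
  move=> z; rewrite -ball_normE /ball_/= /F/= => yz; rewrite cl_id//.
  by rewrite -(subrKA y); apply: le_lt_trans (ler_normD _ _) _; rewrite -ltrBrDl.
exists rho => // q d r c rrho Tc s s0 sr.
have x0s : `|x0 - (x0 + s *: d)| < rho.
  by rewrite opprD addrA subrr sub0r normrN normrZ (ger0_norm s0) (lt_le_trans sr).
have x00 : `|x0 - x0| < rho by rewrite subrr normr0.
have := @mean_value_lipschitz R n m F (tau * n%:R) _ lipF q d x0 r c _ s s0 sr.
rewrite /F/= (cl_id _ x0s) (cl_id _ x00); apply; first by rewrite mulr_ge0.
move=> y xy dF; have xyr := lt_le_trans xy rrho.
rewrite (near_eq_derive _ (nearF _ xyr)); apply: Tc => //.
exact: near_eq_differentiable (nearF _ xyr) dF.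
Qed.

Lemma differentiable_bound y r d : O y -> differentiable Theta y ->
  dot r ('D_d Theta y) <= tau * enorm r * enorm d.
Proof.
move=> Oy dT.
suff : [set t : R^o | t <= tau * enorm r * enorm d] (dot r ('D_d Theta y)) by [].
apply: closed_cvg (cvg_dot_derive dT); first exact: closed_le.
have /nbhs_ballP[e /= e0 eO] : nbhs y O by exact: open_nbhs_nbhs.
apply/nbhs_ballP; exists (e / (`|d| + 1)) => /=.
  by rewrite divr_gt0// ltr_wpDl.
move=> h; rewrite -ball_normE /ball_/= sub0r normrN ltr_pdivlMr ?ltr_wpDl// => he h0.
have Oh : O (h *: d + y).
  apply: eO; rewrite -ball_normE /ball_/= opprD addrCA subrr addr0 normrN normrZ.
  by apply: le_lt_trans he; rewrite ler_wpM2l// lerDl.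
apply: le_trans (dot_le _ _) _; rewrite enormZ (mulrC tau) -mulrA ler_wpM2l ?enorm_ge0//.
rewrite normfV ler_pdivrMl ?normr_gt0//.
apply: le_trans (lipT Oh Oy) _; rewrite addrK enormZ.
by rewrite mulrCA.
Qed.

(** Upper semicontinuity: the Jacobians at points tending to [x0] are bounded by [tau] entrywise,
    hence cluster at some [A], and the inequality passes to the limit. *)
Lemma limiting_jacobian_dot q d c :
  (forall r, 0 < r -> exists z, [/\ `|x0 - z| < r, differentiable Theta z &
    c <= dot q ('D_d Theta z)]) ->
  exists A, limiting_jacobian Theta x0 A /\ c <= dot (q *m A) d.
Proof.
have /nbhs_ballP[e /= e0 eO] : nbhs x0 O by exact: open_nbhs_nbhs.
move=> H.
have rk k : 0 < Num.min (e : R) k.+1%:R^-1.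
  by rewrite lt_min; apply/andP; split=> //; rewrite invr_gt0 ltr0n.
have [z zP] := choice (fun k => H _ (rk k)).
have zO k : O (z k).
  apply: eO; rewrite -ball_normE /ball_/=.
  by have [] := zP k; rewrite lt_min => /andP[].
pose J k := (jacobian Theta (z k))^T.
have [A AP] : exists A : 'M[R]_(m, n), forall k, exists i, (k <= i)%N /\ `|A - J i| < k.+1%:R^-1.
  apply: (@bounded_mx_cluster _ _ _ _ tau) => k i j.
  have [_ dz _] := zP k.
  (* Each entry is a pairing with basis vectors; s = 1 and s = -1 give the two sides of the
     bound. *)
  have JE (s : R) : s * J k i j = dot (s *: delta_mx 0 i) ('D_(delta_mx 0 j) Theta (z k)).
    rewrite deriveEjacobian// dotZl -rowE /dot (bigD1 i)//= big1 ?addr0.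
      by rewrite /J !mxE !eqxx mul1r.
    by move=> l li; rewrite mxE eqxx/= (negbTE li) mul0r.
  have de k' (l : 'I_k') : enorm (delta_mx 0 l : 'rV[R]_k') = 1.
    rewrite /enorm /dot (bigD1 l)//= big1 ?addr0; first by rewrite !mxE !eqxx mulr1 sqrtr1.
    by move=> i' i'l; rewrite mxE eqxx/= (negbTE i'l) mul0r.
  have bnd s : `|s| = 1 -> s * J k i j <= tau.
    move=> s1; rewrite JE; apply: le_trans (differentiable_bound _ _ (zO k) dz) _.
    by rewrite enormZ !de s1 !mulr1.
  rewrite ler_norml; apply/andP; split.
    by rewrite lerNl -mulN1r bnd// normrN normr1.
  by rewrite -[leLHS]mul1r bnd// normr1.
have [i iP] := choice AP.
exists A; split.
  exists (z \o i); split => [k| |].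
  - by have [] := zP (i k).
  - apply/cvgrPdist_lt => r r0; near=> k; have [ki _] := iP k.
    have [+ _ _] := zP (i k); rewrite lt_min => /andP[_ /lt_trans]; apply.
    apply: (@le_lt_trans _ _ k.+1%:R^-1); first by rewrite lef_pV2 ?posrE// ler_nat ltnS.
    near: k; exact: near_infty_natSinv_lt (PosNum r0).
  - apply/cvgrPdist_lt => r r0; near=> k; have [_ /lt_trans] := iP k; apply.
    near: k; exact: near_infty_natSinv_lt (PosNum r0).
apply/ler_addgt0Pr => r r0.
pose B := n%:R * m%:R * `|q| * `|d| + 1.
have B0 : 0 < B by rewrite ltr_wpDl// !mulr_ge0.
have rB : 0 < r / B by rewrite divr_gt0.
have [k _ /(_ k (leqnn k)) kr] := near_infty_natSinv_lt (PosNum rB).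
have [_ Ak] := iP k; have [_ dz cz] := zP (i k).
apply: le_trans cz _; rewrite deriveEjacobian//.
rewrite -[jacobian _ _]trmxK -dot_mulmx -/(J (i k)).
rewrite -lerBlDl -dotBl -mulmxBr.
apply: le_trans (ler_norm _) _; apply: le_trans (dot_mulmx_le _ _ _) _.
apply: (@le_trans _ _ (B * `|J (i k) - A|)).
  by rewrite ler_wpM2r// /B lerDl.
rewrite distrC -ler_pdivlMl// mulrC; apply/ltW; apply: lt_trans Ak _.
exact: kr.
Unshelve. all: by end_near. Qed.

End clarke.

(** * Sublinear functionals and convex separation *)

Lemma convex_setP (R : realType) (V : lmodType R) (A : set V) :
  convex_set A <-> forall x y (a : R), A x -> A y -> 0 <= a <= 1 ->
    A (a *: x + (1 - a) *: y).
Proof.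
split=> [cA x y a Ax Ay /andP[a0 a1]|cA x y l /[!inE] Ax Ay].
  have := cA x y (Itv01 a0 a1); rewrite !inE; exact.
by apply: cA => //; rewrite ge0 le1.
Qed.

Section sublinear.
Variables (R : realType) (n : nat).
Implicit Types (p : 'rV[R]_n -> R) (e d : 'rV[R]_n).

Definition sublinear p :=
  (forall x y, p (x + y) <= p x + p y) /\
  (forall (t : R) x, 0 < t -> p (t *: x) = t * p x).

(** One step of the finite-dimensional Hahn-Banach argument: a sublinear minorant of [p] that is
    linear along [e]. *)
Definition linearize p e d := inf [set p (d + t *: e) - t * p e | t in [set t : R | 0 <= t]].

Lemma sublinear0 p : sublinear p -> p 0 = 0.
Proof. by move=> [_ /(_ 2 0)]; rewrite scaler0 ltr0n => /(_ isT); lra. Qed.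

Lemma linearize_lb p e d t : sublinear p -> 0 <= t -> - p (- d) <= p (d + t *: e) - t * p e.
Proof.
move=> sp t0.
have : t * p e <= p (d + t *: e) + p (- d).
  have -> : t * p e = p (t *: e).
    move: t0; rewrite le_eqVlt => /predU1P[<-|t0]; last by rewrite sp.2.
    by rewrite scale0r mul0r sublinear0.
  by have := sp.1 (d + t *: e) (- d); rewrite addrAC subrr add0r.
by lra.
Qed.

Lemma linearize_le p e d t : sublinear p -> 0 <= t ->
  linearize p e d <= p (d + t *: e) - t * p e.
Proof.
move=> sp t0; apply: ge_inf; last by exists t.
by exists (- p (- d)) => _ [s s0 <-]; exact: linearize_lb.
Qed.

Lemma linearize_ge p e d c : (forall t, 0 <= t -> c <= p (d + t *: e) - t * p e) ->
  c <= linearize p e d.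
Proof.
move=> H; apply: lb_le_inf; last by move=> _ [t t0 <-]; exact: H.
by exists (p (d + 0 *: e) - 0 * p e), 0 => /=.
Qed.

Lemma linearize_le0 p e d : sublinear p -> linearize p e d <= p d.
Proof.
by move=> sp; have := linearize_le e d sp (lexx 0); rewrite scale0r addr0 mul0r subr0.
Qed.

Lemma sublinear_linearize p e : sublinear p -> sublinear (linearize p e).
Proof.
move=> sp.
have lez (t : R) x : 0 < t -> linearize p e (t *: x) <= t * linearize p e x.
  move=> t0; rewrite -ler_pdivrMl//; apply: linearize_ge => s s0.
  rewrite ler_pdivrMl//; apply: le_trans (linearize_le _ _ sp (mulr_ge0 (ltW t0) s0)) _.
  by rewrite -scalerA -scalerDr sp.2// -mulrA -mulrBr.
split=> [x y|t x t0]; last first.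
  apply/eqP; rewrite eq_le lez//=.
  have ti0 : 0 < t^-1 by rewrite invr_gt0.
  have := lez _ (t *: x) ti0; rewrite scalerA mulVf ?gt_eqF// scale1r.
  by rewrite ler_pdivlMl.
rewrite -lerBlDr; apply: linearize_ge => s s0.
rewrite lerBlDr -lerBlDl; apply: linearize_ge => t t0; rewrite lerBlDl.
apply: le_trans (linearize_le _ _ sp (addr_ge0 s0 t0)) _.
rewrite scalerDl addrACA mulrDl.
have := sp.1 (x + s *: e) (y + t *: e); lra.
Qed.

(** Sublinearity gives the opposite inequality, so this means p(-e) = -p(e). In this form it is
    inherited by every smaller functional. *)
Definition linear_along p e := p e + p (- e) <= 0.

Lemma linearize_linear p e : sublinear p -> linear_along (linearize p e) e.
Proof.
move=> sp; rewrite /linear_along.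
have H1 := linearize_le0 e e sp.
have := linearize_le e (- e) sp ler01.
rewrite scale1r addNr sublinear0// mul1r sub0r; lra.
Qed.

(** Linearize along the basis vectors one after another; linearity already gained survives because
    later functionals are smaller. A sublinear functional linear along every axis lies below the
    linear form with the same values on the basis, and applying this at -d gives the bound from
    below. *)
Lemma hahn_banach p : sublinear p -> exists w, forall d, dot w d <= p d.
Proof.
move=> sp.
have [p' [sp' p'p p'l]] : exists p', [/\ sublinear p', forall d, p' d <= p d &
    forall i : 'I_n, linear_along p' (delta_mx 0 i)].
  have : forall s : seq 'I_n, exists p', [/\ sublinear p', forall d, p' d <= p d &
    forall i, i \in s -> linear_along p' (delta_mx 0 i)].
    elim=> [|i s [p' [sp' p'p p'l]]]; first by exists p.
    exists (linearize p' (delta_mx 0 i)); split.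
    - exact: sublinear_linearize.
    - by move=> d; exact: le_trans (linearize_le0 _ _ sp') (p'p d).
    - move=> j; rewrite inE => /predU1P[->|/p'l js]; first exact: linearize_linear.
      by apply: le_trans js; rewrite lerD// linearize_le0.
  move=> /(_ (enum 'I_n)) [p' [? ? p'l]]; exists p'; split => // i.
  by apply: p'l; rewrite mem_enum.
exists (\row_i p' (delta_mx 0 i)) => d; apply: le_trans (p'p d).
have p'0 := sublinear0 sp'.
have p'Z (t : R) i : p' (t *: delta_mx 0 i) <= t * p' (delta_mx 0 i).
  have [t0|t0|->] := ltrgtP t 0; last by rewrite scale0r p'0 mul0r.
    have := p'l i; rewrite /linear_along => pl.
    have -> : t *: delta_mx 0 i = (- t) *: (- delta_mx 0 i) :> 'rV[R]_n.
      by rewrite scalerN scaleNr opprK.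
    by rewrite sp'.2 ?oppr_gt0//; nra.
  by rewrite sp'.2.
have le_sum x : p' x <= \sum_i x 0 i * p' (delta_mx 0 i).
  rewrite {1}[x]row_sum_delta.
  elim/big_ind2 : _ => [|a b a' b' ab a'b'|i _]; last exact: p'Z.
    by rewrite p'0.
  by apply: le_trans (sp'.1 _ _) _; rewrite lerD.
have -> : dot (\row_i p' (delta_mx 0 i)) d = \sum_i d 0 i * p' (delta_mx 0 i).
  by apply: eq_bigr => i _; rewrite mxE mulrC.
have -> : \sum_i d 0 i * p' (delta_mx 0 i) = - \sum_i (- d) 0 i * p' (delta_mx 0 i).
  by rewrite -sumrN; apply: eq_bigr => i _; rewrite mxE mulNr opprK.
have := le_sum (- d); have := sp'.1 d (- d); rewrite subrr p'0; lra.
Qed.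

End sublinear.

(* The functional [p d = inf s (f1 y + f2 z)] over [s (z - y) = d] is sublinear,
   and a linear minorant of it separates [f1] and [- f2]. *)
Section sandwich.
Variables (R : realType) (n : nat) (U D : set 'rV[R]_n) (f1 f2 : 'rV[R]_n -> R).
Variable x : 'rV[R]_n.
Hypothesis cU : convex_set U.
Hypothesis cD : convex_set D.
Hypothesis Ux : U x.
Hypothesis coreD : forall d, exists2 t : R, 0 < t & D (x + t *: d).
Hypothesis cf1 : forall y z (a : R), U y -> U z -> 0 <= a <= 1 ->
  f1 (a *: y + (1 - a) *: z) <= a * f1 y + (1 - a) * f1 z.
Hypothesis cf2 : forall y z (a : R), D y -> D z -> 0 <= a <= 1 ->
  f2 (a *: y + (1 - a) *: z) <= a * f2 y + (1 - a) * f2 z.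
Hypothesis f1x : f1 x = 0.
Hypothesis f2x : f2 x = 0.
Hypothesis f12 : forall y, U y -> D y -> 0 <= f1 y + f2 y.

Let Q d := [set v | exists s y z, [/\ 0 < s, U y, D z, s *: (z - y) = d &
  s * (f1 y + f2 z) = v]].

(** Perspectives of convex functions are subadditive: the two pairs of points are averaged with
    weights s/(s+s') and s'/(s+s'). *)
Let Q_add d v d' v' : Q d v -> Q d' v' -> exists2 w, Q (d + d') w & w <= v + v'.
Proof.
move=> [s [y [z [s0 Uy Dz <- <-]]]] [s' [y' [z' [s'0 Uy' Dz' <- <-]]]].
pose S := s + s'; have S0 : 0 < S by rewrite addr_gt0.
pose a := s / S.
have a01 : 0 <= a <= 1.
  apply/andP; split; first by rewrite divr_ge0// ltW.
  by rewrite ler_pdivrMr// mul1r lerDl ltW.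
have Sa : S * a = s by rewrite mulrC divfK// gt_eqF.
have S1a : S * (1 - a) = s' by rewrite mulrBr mulr1 Sa /S addrAC subrr add0r.
move: a Sa S1a a01 => a Sa S1a a01.
pose yy := a *: y + (1 - a) *: y'; pose zz := a *: z + (1 - a) *: z'.
exists (S * (f1 yy + f2 zz)).
  exists S, yy, zz; split => //; [exact: (convex_setP _).1|exact: (convex_setP _).1|].
  by rewrite /yy /zz opprD addrACA -!scalerBr scalerDr !scalerA Sa S1a.
have H1 := cf1 Uy Uy' a01; have H2 := cf2 Dz Dz' a01.
have -> : s * (f1 y + f2 z) + s' * (f1 y' + f2 z') =
    S * (a * (f1 y + f2 z) + (1 - a) * (f1 y' + f2 z')).
  by rewrite -Sa -S1a -!mulrA -mulrDr.
rewrite ler_pM2l// /yy /zz; lra.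
Qed.

Let Q0 v : Q 0 v -> 0 <= v.
Proof.
move=> [s [y [z [s0 Uy Dz + <-]]]] => /eqP; rewrite scaler_eq0 gt_eqF//= subr_eq0 => /eqP zy.
move: Dz; rewrite zy => Dy; apply: mulr_ge0; [exact: ltW|exact: f12].
Qed.

Let Q_neq0 d : exists v, Q d v.
Proof.
have [t t0 Dt] := coreD d.
exists (t^-1 * (f1 x + f2 (x + t *: d))), t^-1, x, (x + t *: d).
split => //; first by rewrite invr_gt0.
by rewrite addrAC subrr add0r scalerA mulVf ?gt_eqF// scale1r.
Qed.

Let QZ t d v : 0 < t -> Q d v -> Q (t *: d) (t * v).
Proof.
move=> t0 [s [y [z [s0 Uy Dz <- <-]]]]; exists (t * s), y, z; split => //.
- by rewrite mulr_gt0.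
- by rewrite scalerA.
- by rewrite mulrA.
Qed.

Let p d := inf (Q d).

Let p_le d v : Q d v -> p d <= v.
Proof.
move=> Qd; have [v0 Qd0] := Q_neq0 (- d).
apply: ge_inf => //; exists (- v0) => w Qw.
have [u + uw] := Q_add Qw Qd0; rewrite subrr => /Q0; lra.
Qed.

Let p_ge d c : (forall v, Q d v -> c <= v) -> c <= p d.
Proof. by move=> H; apply: lb_le_inf => //; exact: Q_neq0. Qed.

Let sub_p : sublinear p.
Proof.
have lez t d : 0 < t -> p (t *: d) <= t * p d.
  move=> t0; rewrite -ler_pdivrMl//; apply: p_ge => v /(QZ t0) /p_le.
  by rewrite ler_pdivrMl.
split=> [d d'|t d t0]; last first.
  apply/eqP; rewrite eq_le lez//=.
  have ti0 : 0 < t^-1 by rewrite invr_gt0.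
  have := lez _ (t *: d) ti0; rewrite scalerA mulVf ?gt_eqF// scale1r.
  by rewrite ler_pdivlMl.
rewrite -lerBlDr; apply: p_ge => v Qv; rewrite lerBlDr -lerBlDl.
apply: p_ge => v' Qv'; rewrite lerBlDl.
have [w /p_le Qw wv] := Q_add Qv Qv'; exact: le_trans wv.
Qed.

(** Freezing one of the two points at [x], where both functions vanish, isolates [f1] and [f2] in
    the definition of [p]. [coreD] provides an element of [Q d] for every d, so that the infimum is
    meaningful. *)
Lemma sandwich : exists w, (forall y, U y -> dot w (y - x) <= f1 y) /\
  (forall z, D z -> - dot w (z - x) <= f2 z).
Proof.
have [w wp] := hahn_banach sub_p.
have Dx : D x.
  by have [t t0] := coreD 0; rewrite scaler0 addr0.
exists (- w); split => [y Uy|z Dz].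
  rewrite dotNl -dotNr opprB; apply: le_trans (wp _) _; apply: p_le.
  exists 1, y, x; split => //; first by rewrite scale1r.
  by rewrite mul1r f2x addr0.
rewrite dotNl opprK; apply: le_trans (wp _) _; apply: p_le.
exists 1, x, z; split => //; first by rewrite scale1r.
by rewrite mul1r f1x add0r.
Qed.

End sandwich.

(* An almost nearest point of S to x already separates. *)
Lemma support_approx (R : realType) (n : nat) (S : set 'rV[R]_n) (B : R)
    (x : 'rV[R]_n) :
  convex_set S -> S !=set0 -> (forall s, S s -> enorm s <= B) ->
  (forall d c, (forall s, S s -> dot s d <= c) -> dot x d <= c) ->
  forall e, 0 < e -> exists2 s, S s & enorm (s - x) <= e.
Proof.
move=> /convex_setP cS [s1 Ss1] SB sup e e0.
apply: contrapT => /forall2NP far.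
have {}far s : S s -> e < enorm (s - x).
  by move=> Ss; have [//|/negP] := far s; rewrite -ltNge.
pose E := [set enorm (s - x) ^+ 2 | s in S].
have infE : has_inf E.
  split; first by exists (enorm (s1 - x) ^+ 2), s1.
  by exists 0 => _ [s _ <-]; rewrite sqr_ge0.
pose delta := inf E.
have delta_le s : S s -> delta <= enorm (s - x) ^+ 2.
  by move=> Ss; apply: ge_inf; [exact: infE.2|exists s].
have delta_e : e ^+ 2 <= delta.
  apply: lb_le_inf; first exact: infE.1.
  move=> _ [s Ss <-]; rewrite ler_pXn2r ?nnegrE ?enorm_ge0 ?(ltW e0)//.
  exact/ltW/far.
have B0 : 0 <= B by exact: le_trans (enorm_ge0 _) (SB _ Ss1).
have e2 : 0 < e ^+ 2 by rewrite exprn_gt0.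
have B8 : 0 < 8 * B ^+ 2 + 8 by have := sqr_ge0 B; lra.
(* The points of S are at most 2B apart. Comparing [s0] with the point at fraction t towards s
   bounds the pairing of x - [s0] with s - [s0] by e^2/4 + 2 t B^2. This t makes that at most e^2/2,
   and [s0] must be optimal up to t e^2/2. Passing from s to x then gives |x - [s0]|^2 <= e^2/2,
   contradicting that it is at least e^2. The summand 8 keeps the denominator positive. *)
pose t := Num.min 1 (e ^+ 2 / (8 * B ^+ 2 + 8)).
have t0 : 0 < t by rewrite lt_min ltr01/= divr_gt0.
have t1 : t <= 1 by rewrite ge_min lexx.
have tB : t * (8 * B ^+ 2 + 8) <= e ^+ 2 by rewrite -ler_pdivlMr// ge_min lexx orbT.
have te : 0 < t * e ^+ 2 / 2 by rewrite divr_gt0// mulr_gt0.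
have [_ [s0 Ss0 <-] s0d] := inf_adherent te infE.
have key s : S s -> dot s (x - s0) <= dot s0 (x - s0) + e ^+ 2 / 2.
  move=> Ss; have t01 : 0 <= t <= 1 by rewrite ltW.
  have := delta_le _ (cS _ _ _ Ss Ss0 t01); rewrite -/delta in s0d.
  have -> : t *: s + (1 - t) *: s0 - x = (s0 - x) + t *: (s - s0).
    by rewrite scalerBl scale1r scalerBr addrCA [LHS]addrAC addrA.
  have ss0 : dot (s - s0) (s - s0) <= (2 * B) ^+ 2.
    rewrite -enorm_sqr ler_pXn2r ?nnegrE ?enorm_ge0 ?mulr_ge0//.
    apply: le_trans (enormB _ _) _; have := SB _ Ss; have := SB _ Ss0; lra.
  move: s0d; rewrite !enorm_sqr; move: ss0 tB.
  rewrite !dotE !(dotC _ s) !(dotC _ s0) !(dotC _ x) => ss0 tB s0d H.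
  nra.
have := sup _ _ key; rewrite -subr_ge0.
have := le_trans delta_e (delta_le _ Ss0); rewrite enorm_sqr !dotE (dotC s0 x); lra.
Qed.

Section clarke_jacobian.
Variables (R : realType) (n m : nat) (Theta : 'rV[R]_n -> 'rV[R]_m).

Lemma clarke_jacobian_convex x : convex_set (clarke_jacobian Theta x).
Proof.
apply/convex_setP => A B a cA cB a01 S [cS limS].
by apply: (convex_setP _).1 => //; [exact: cA|exact: cB].
Qed.

Lemma limiting_clarke x A : limiting_jacobian Theta x A -> clarke_jacobian Theta x A.
Proof. by move=> lA S [_]; apply. Qed.

Variables (tau : R) (O : set 'rV[R]_n).
Hypothesis tau0 : 0 <= tau.
Hypothesis oO : open O.
Hypothesis lipT : elipschitz tau O Theta.
Variable x : 'rV[R]_n.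
Hypothesis Ox : O x.

(** The inequality is affine in A, so it is enough to have it for limiting Jacobians, where it is a
    limit of bounds on derivatives. *)
Lemma clarke_jacobian_bound A r d : clarke_jacobian Theta x A ->
  dot (r *m A) d <= tau * enorm r * enorm d.
Proof.
suff sub : clarke_jacobian Theta x `<=`
    [set A | forall r d, dot (r *m A) d <= tau * enorm r * enorm d].
  by move=> /sub; exact.
apply: smallest_sub.
  apply/convex_setP => B C a HB HC /andP[a0 a1] r' d'.
  have := HB r' d'; have := HC r' d'.
  by rewrite mulmxDr -!scalemxAr !dotE; nra.
move=> B [y [dy yx yB]] r' d'.
have cB : continuous (fun M : 'M[R]_(m, n) => dot (r' *m M) d' : R^o).
  apply: (@lipschitz_continuous R _ R^o (n%:R * m%:R * `|r'| * `|d'|)) => M N.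
  by rewrite -dotBl -mulmxBr; exact: dot_mulmx_le.
suff : [set t : R^o | t <= tau * enorm r' * enorm d'] (dot (r' *m B) d') by [].
apply: closed_cvg (cvg_comp _ _ yB (cB B)); first exact: closed_le.
have : \forall i \near \oo, O (y i) by apply: yx; exact: open_nbhs_nbhs.
apply: filterS => i Oyi /=.
rewrite dot_mulmx trmxK -deriveEjacobian//.
exact: (differentiable_bound oO lipT).
Qed.

Lemma clarke_jacobian_enorm A r : clarke_jacobian Theta x A ->
  enorm (r *m A) <= tau * enorm r.
Proof.
move=> /(clarke_jacobian_bound r (r *m A)); rewrite -enorm_sqr.
have [->|nz] := eqVneq (enorm (r *m A)) 0; first by rewrite mulr_ge0 ?enorm_ge0.
by rewrite expr2 ler_pM2r// lt_neqAle eq_sym nz enorm_ge0.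
Qed.

(* Clarke's directional estimate; the case [d = 0], [c < 0] shows that the
   Clarke Jacobian is nonempty. *)
Lemma clarke_jacobian_mean q d c e :
  (forall A, clarke_jacobian Theta x A -> dot (q *m A) d <= c) -> 0 < e ->
  exists2 delta, 0 < delta & forall s, 0 <= s <= delta ->
    dot q (Theta (x + s *: d) - Theta x) <= (c + e) * s.
Proof.
move=> Ac e0.
have [rho rho0 rhoP] := mean_value_local tau0 oO lipT Ox.
have [r [r0 rrho rP]] : exists r, [/\ 0 < r, r <= rho &
    forall y, `|x - y| < r -> differentiable Theta y -> dot q ('D_d Theta y) <= c + e].
  apply: contrapT => /forallNP nr.
  have [A [lA]] : exists A, limiting_jacobian Theta x A /\ c + e <= dot (q *m A) d.
    apply: (limiting_jacobian_dot oO lipT Ox) => r r0.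
    have r'0 : 0 < Num.min r rho by rewrite lt_min r0.
    have := nr (Num.min r rho) => /not_and3P[//||].
      by rewrite ge_min lexx orbT.
    move=> /existsNP[y /not_implyP[xy /not_implyP[dy /negP]]].
    rewrite -ltNge => cy; exists y; split => //; last exact: ltW.
    by move: xy; rewrite lt_min => /andP[].
  have := Ac A (limiting_clarke lA); lra.
have nd1 : 0 < `|d| + 1 by rewrite ltr_wpDl.
exists (r / 2 / (`|d| + 1)); first by rewrite !divr_gt0.
move=> s /andP[s0 sd]; apply: (rhoP _ _ _ _ rrho rP s s0).
move: sd; rewrite ler_pdivlMr// => sd.
have : s * `|d| <= s * (`|d| + 1) by rewrite ler_wpM2l// lerDl.
lra.
Qed.

Lemma clarke_jacobian_neq0 : clarke_jacobian Theta x !=set0.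
Proof.
apply: contrapT => /forallNP nA.
have [| |delta d0 dP] := @clarke_jacobian_mean 0 0 (-1) (2^-1).
- by move=> A /nA.
- by rewrite invr_gt0.
have := dP delta; rewrite lexx ltW// dot0l => /(_ isT); nra.
Qed.

End clarke_jacobian.

(** * Optimality conditions *)

Section kkt.
Variables (R : realType) (n m : nat) (J : 'rV[R]_n -> \bar R).
Variables (Theta : 'rV[R]_n -> 'rV[R]_m) (U : set 'rV[R]_n).
Hypothesis cU : convex_set U.
Hypothesis J_fin : forall x, U x -> J x \is a fin_num.
Hypothesis J_cont : forall x, U x -> {for x, continuous J}.
Hypothesis J_proper : proper J.
Hypothesis J_convex : econvex J.

Let j y := fine (J y).
Let D := [set y | J y \is a fin_num].

Let JD y : D y -> J y = (j y)%:E.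
Proof. by move=> Dy; rewrite /j fineK. Qed.

Let j_convex y z (a : R) : D y -> D z -> 0 <= a <= 1 ->
  D (a *: y + (1 - a) *: z) /\ j (a *: y + (1 - a) *: z) <= a * j y + (1 - a) * j z.
Proof.
move=> Dy Dz /andP[]; rewrite le_eqVlt => /predU1P[<- _|a0].
  by rewrite scale0r add0r subr0 scale1r mul0r mul1r add0r.
rewrite le_eqVlt => /predU1P[->|a1].
  by rewrite subrr scale0r addr0 scale1r mul0r mul1r addr0.
have := J_convex y z (t := a); rewrite a0 a1 => /(_ isT).
rewrite (JD Dy) (JD Dz) -!EFinM -EFinD => H.
have Ds : D (a *: y + (1 - a) *: z).
  rewrite /D/= fin_numE J_proper.1/=; apply/negP => /eqP E.
  by move: H; rewrite E leye_eq.
by split => //; move: H; rewrite (JD Ds) lee_fin.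
Qed.

Let D_convex : convex_set D.
Proof. by apply/convex_setP => y z a Dy Dz /(j_convex Dy Dz)[]. Qed.

(** Continuity of [J] at a point where it is finite makes it finite nearby. This is the
    qualification condition of the second separation in [kkt_approx]. *)
Let D_core x d : U x -> exists2 t : R, 0 < t & D (x + t *: d).
Proof.
move=> Ux; have Dx : D x by exact: J_fin.
have Jx : J @ x --> J x := J_cont Ux.
move: Jx; rewrite (JD Dx) => /fine_cvgP[+ _].
move=> /nbhs_ballP[e /= e0 eP].
have d1 : 0 < `|d| + 1 by rewrite ltr_wpDl.
have t0 : 0 < e / (`|d| + 1) / 2 by rewrite !divr_gt0.
exists (e / (`|d| + 1) / 2) => //; apply: eP.
rewrite -ball_normE /ball_/= opprD addrA subrr sub0r normrN normrZ gtr0_norm//.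
rewrite mulrAC ltr_pdivrMr// mulrAC ltr_pdivrMr//.
have := normr_ge0 d; nra.
Qed.

Lemma kkt_approx x g q tau O : 0 <= tau -> open O -> elipschitz tau O Theta ->
  U `<=` O -> U x ->
  (forall y, U y -> 0 <= dot g (y - x) + j y - j x + dot q (Theta y - Theta x)) ->
  forall e, 0 < e -> exists xi A nu, [/\ subdifferential J x xi,
    clarke_jacobian Theta x A, normal_cone U x nu &
    enorm (g + xi + q *m A + nu) <= e].
Proof.
move=> tau0 oO lipT UO Ux VI e e0.
have Ox := UO _ Ux; have UD : U `<=` D by exact: J_fin.
have [A0 cA0] := clarke_jacobian_neq0 tau0 oO lipT Ox.
have cb := @clarke_jacobian_bound _ _ _ _ _ _ oO lipT _ Ox.
pose E d := [set dot (q *m A) d | A in clarke_jacobian Theta x].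
pose sigma d := sup (E d).
have supE d : has_sup (E d).
  split; first by exists (dot (q *m A0) d), A0.
  by exists (tau * enorm q * enorm d) => _ [A cA <-]; exact: cb.
have sigma_ub d A : clarke_jacobian Theta x A -> dot (q *m A) d <= sigma d.
  by move=> cA; apply: (ub_le_sup (supE d).2); exists A.
have sigma_le d c : (forall A, clarke_jacobian Theta x A -> dot (q *m A) d <= c) ->
    sigma d <= c.
  by move=> H; apply: ge_sup; [exact: (supE d).1|move=> _ [A cA <-]; exact: H].
(* The hypothesis compares values at finite distance. It is used at x + s (y - x) for small s, where
   convexity of [j] and Clarke's estimate both scale with s; then divide by s. *)
have f12 y : U y -> 0 <= (j y - j x + dot g (y - x)) + sigma (y - x).
  move=> Uy; apply/ler_addgt0Pr => r r0.
  have [delta d0 dP] := clarke_jacobian_mean tau0 oO lipT Ox (@sigma_ub (y - x)) r0.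
  pose s := Num.min 1 delta.
  have s0 : 0 < s by rewrite lt_min ltr01.
  have s1 : s <= 1 by rewrite ge_min lexx.
  have sd : s <= delta by rewrite ge_min lexx orbT.
  have s01 : 0 <= s <= 1 by rewrite ltW.
  have yE : x + s *: (y - x) = s *: y + (1 - s) *: x.
    by rewrite scalerBr scalerBl scale1r addrA addrAC addrC addrA addrAC.
  have Uys : U (x + s *: (y - x)) by rewrite yE; exact: (convex_setP _).1.
  have [_ jys] := j_convex (UD _ Uy) (UD _ Ux) s01.
  have := VI _ Uys; have := dP s; rewrite ltW// => /(_ sd).
  rewrite (addrC x) addrK -addrA -(addrC x) dotZr yE => H1 H2.
  have : 0 <= s * ((j y - j x + dot g (y - x)) + sigma (y - x) + r).
    by move: jys H1 H2; nra.
  by rewrite pmulr_rge0.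
have DT : convex_set ([set: 'rV[R]_n]) by apply/convex_setP.
(* First split: J and the linear term, restricted to [U], against the support function [sigma],
   which is finite on the whole space. *)
have [| | | |w [w1 w2]] := @sandwich R n U setT (fun y => j y - j x + dot g (y - x))
  (fun y => sigma (y - x)) x cU DT Ux (fun d => ex_intro2 _ _ 1 ltr01 I) _ _ _ _
  (fun y Uy _ => f12 y Uy).
- by move=> y z a Uy Uz a01; have [_] := j_convex (UD _ Uy) (UD _ Uz) a01; rewrite !dotE; lra.
- move=> y z a _ _ /andP[a0 a1]; apply: sigma_le => A cA.
  have Hy := sigma_ub (y - x) A cA; have Hz := sigma_ub (z - x) A cA.
  have -> : a *: y + (1 - a) *: z - x = a *: (y - x) + (1 - a) *: (z - x).
    by rewrite !scalerBr addrACA -opprD -scalerDl subrKC scale1r.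
  by rewrite dotDr !dotZr lerD// ler_wpM2l// subr_ge0.
- by rewrite !subrr dot0r addr0.
- apply/eqP; rewrite subrr eq_le; apply/andP; split.
    by apply: sigma_le => A cA; rewrite dot0r.
  by have := sigma_ub 0 A0 cA0; rewrite dot0r.
(* By [w2] the vector -w lies below the support function of the set of all q A, so some q A is
   within e of it. *)
have [_ [A cA <-] Aw] : exists2 s, [set q *m A | A in clarke_jacobian Theta x] s &
    enorm (s - (- w)) <= e.
  apply: (@support_approx _ _ _ (tau * enorm q)) => //.
  - apply/convex_setP => _ _ a [B cB <-] [B' cB' <-] a01.
    exists (a *: B + (1 - a) *: B').
      by apply: (convex_setP _).1 => //; exact: clarke_jacobian_convex.
    by rewrite mulmxDr -!scalemxAr.
  - by exists (q *m A0), A0.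
  - by move=> _ [B cB <-]; exact: (clarke_jacobian_enorm tau0 oO lipT Ox).
  - move=> d c Hc; have := w2 (x + d) I; rewrite addrAC subrr add0r dotNl => /le_trans.
    by apply; apply: sigma_le => B cB; apply: Hc; exists B.
(* Second split: by [w1], J minus the linear form w - g is minimal over [U] at x. Separating it from
   the zero function on [U] gives a normal vector [nu] and the subgradient w - g - nu. *)
have [| | | | |nu [nu1 nu2]] := @sandwich R n U D (fun=> 0)
  (fun y => j y - j x - dot (w - g) (y - x)) x cU D_convex Ux (fun d => D_core d Ux).
- by move=> y z a _ _ _; rewrite !mulr0 addr0.
- by move=> y z a Dy Dz a01; have [_] := j_convex Dy Dz a01; rewrite !dotE; lra.
- by [].
- by rewrite !subrr dot0r subrr.
- by move=> y Uy _; have := w1 y Uy; rewrite !dotE; lra.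
exists (w - g - nu), A, nu; split => //.
- move=> y; have [Dy|] := pselect (D y).
    rewrite (JD Dy) (JD (UD _ Ux)) -EFinD lee_fin.
    by have := nu2 y Dy; rewrite !dotE; lra.
  rewrite /D/= fin_numE J_proper.1/= => /negP/negPn/eqP ->.
  exact: leey.
- suff -> : g + (w - g - nu) + q *m A + nu = q *m A - - w by [].
  by rewrite opprK addrAC addrA subrKC subrK addrC.
Qed.

End kkt.

(** * Convergence of the algorithm *)

Lemma harmonic_unbounded (R : realType) (c M : R) (n : nat) : 0 < c ->
  ~ (forall N, \sum_(k < N) c / (n + k).+1%:R <= M).
Proof.
move=> c0 H; apply: (@dvg_harmonic R).
suff : cvgn (series (@harmonic R)) by [].
apply: nondecreasing_is_cvgn.
  by apply: nondecreasing_series => k _ _; rewrite /harmonic/= invr_ge0.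
exists (series harmonic n + M / c) => _ [N _ <-].
have [Nn|nN] := leqP N n.
  have h0 : 0 <= M / c.
    by rewrite divr_ge0 ?(ltW c0)//; have := H 0%N; rewrite big_ord0.
  apply: (@le_trans _ _ (series harmonic n)); last by rewrite lerDl.
  apply: nondecreasing_series => // k _ _; by rewrite /harmonic/= invr_ge0.
rewrite /series/= -(subnKC (ltnW nN)) (big_cat_nat _ (n := n))//=; last exact: leq_addr.
rewrite lerD2l ler_pdivlMr// -{1}[n]add0n big_addn addKn big_mkord mulr_suml.
apply: le_trans (H (N - n)%N); apply: ler_sum => k _.
by rewrite mulrC addnC.
Qed.

(** All tail infima vanish, not only their limit. The index shift by 2 reflects the Lyapunov step,
    which involves three consecutive iterates: [s k] controls the residual of index k + 2. *)
Lemma limn_einf_sqrt (R : realType) (f : nat -> \bar R) (s : nat -> R) (K M : R) :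
  0 < K -> (forall k, 0 <= s k) -> (forall N, \sum_(k < N) s k ^+ 2 <= M) ->
  (forall k, (0 <= f k)%E) ->
  (forall k, (f k.+2 <= (Num.sqrt k.+2%:R * (K * s k))%:E)%E) ->
  limn_einf f = 0%E.
Proof.
move=> K0 s0 sM f0 fs.
have inf0 n : einfs f n = 0%E.
  apply/eqP; rewrite eq_le; apply/andP; split; last first.
    by apply: le_ereal_inf_tmp => _ [k _ <-].
  apply/lee_addgt0Pr => e e0; rewrite add0e.
  apply: contrapT => /negP; rewrite -ltNge => einf.
  have far k : (n <= k)%N -> (e / K) ^+ 2 / k.+2%:R <= s k ^+ 2.
    move=> nk.
    have : (e%:E < f k.+2)%E.
      by apply: lt_le_trans einf _; apply: ereal_inf_lbound; exists k.+2 => //=; exact/leqW/leqW.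
    move=> /lt_le_trans/(_ (fs k)); rewrite lte_fin => es.
    have es' : e / K <= Num.sqrt k.+2%:R * s k.
      by rewrite ler_pdivrMr// mulrAC -mulrA; exact: ltW.
    rewrite ler_pdivrMr// [leRHS](_ : _ = (Num.sqrt k.+2%:R * s k) ^+ 2); last first.
      by rewrite exprMn sqr_sqrtr// mulrC.
    have eK0 : 0 <= e / K by rewrite divr_ge0// ltW.
    by rewrite ler_pXn2r// nnegrE (le_trans eK0).
  have eK : 0 < (e / K) ^+ 2 by rewrite exprn_gt0// divr_gt0.
  apply: (@harmonic_unbounded R ((e / K) ^+ 2) M n.+1 eK) => N.
  apply: le_trans (sM (n + N)%N).
  rewrite big_split_ord/= -[leLHS]add0r lerD//.
    by apply: sumr_ge0 => k _; rewrite sqr_ge0.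
  by apply: ler_sum => k _; rewrite addSn; apply: far; exact: leq_addr.
rewrite limn_einf_lim (_ : einfs f = cst 0%E); last by apply/funext.
exact: lim_cst.
Qed.

(** Turns minimality along a segment into a variational inequality: divide by t and let it tend to
    0. *)
Lemma first_order_ge0 (R : realType) (a b : R) :
  (forall t, 0 < t -> t <= 1 -> 0 <= t * a + t ^+ 2 * b) -> 0 <= a.
Proof.
move=> H; rewrite leNgt; apply/negP => a0.
have b0 : 0 < 2 * (`|b| + 1) by rewrite mulr_gt0// ltr_wpDl.
pose t := Num.min 1 (- a / (2 * (`|b| + 1))).
have t0 : 0 < t by rewrite lt_min ltr01 divr_gt0// oppr_gt0.
have t1 : t <= 1 by rewrite ge_min lexx.
have tb : t * (2 * (`|b| + 1)) <= - a by rewrite -ler_pdivlMr// ge_min lexx orbT.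
have := H _ t0 t1; have := ler_norm b; have := normr_ge0 b; nra.
Qed.

Lemma proj_le (R : realType) (n : nat) (S : set 'rV[R]_n) x q :
  convex_set S -> proj S x q -> S q /\ forall p, S p -> 0 <= dot (q - x) (p - q).
Proof.
move=> /convex_setP cS [Sq qmin]; split => // p Sp.
suff : 0 <= 2 * dot (q - x) (p - q) by lra.
apply: (@first_order_ge0 _ _ (dot (p - q) (p - q))) => t t0 t1.
have t01 : 0 <= t <= 1 by rewrite ltW.
have := qmin _ (cS _ _ _ Sp Sq t01); rewrite lee_fin => H.
have : enorm (x - q) ^+ 2 <= enorm (x - (t *: p + (1 - t) *: q)) ^+ 2.
  by rewrite ler_pXn2r// nnegrE enorm_ge0.
have -> : x - (t *: p + (1 - t) *: q) = (x - q) - t *: (p - q).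
  by apply/rowP => i; rewrite !mxE; ring.
rewrite !enorm_sqr !dotE !(dotC _ x) !(dotC _ q) => H'; lra.
Qed.

Lemma dual_cone_convex (R : realType) (n : nat) (C : set 'rV[R]_n) :
  convex_set (dual_cone C).
Proof.
apply/convex_setP => x y a Cx Cy /andP[a0 a1] th Cth.
rewrite !dotE; have := Cx _ Cth; have := Cy _ Cth; nra.
Qed.

Section prox.
Variables (R : realType) (n m : nat) (J : 'rV[R]_n -> \bar R).
Variables (Theta : 'rV[R]_n -> 'rV[R]_m) (U : set 'rV[R]_n) (C : set 'rV[R]_m).
Hypothesis cU : convex_set U.
Hypothesis J_fin : forall x, U x -> J x \is a fin_num.
Hypothesis J_convex : econvex J.
Hypothesis cTheta : cone_convex C U Theta.

Lemma fine_convex y z (a : R) : U y -> U z -> 0 <= a <= 1 ->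
  fine (J (a *: y + (1 - a) *: z)) <= a * fine (J y) + (1 - a) * fine (J z).
Proof.
move=> Uy Uz /andP[]; rewrite le_eqVlt => /predU1P[<- _|a0].
  by rewrite scale0r add0r subr0 scale1r mul0r mul1r add0r.
rewrite le_eqVlt => /predU1P[->|a1].
  by rewrite subrr scale0r addr0 scale1r mul0r mul1r addr0.
have Us : U (a *: y + (1 - a) *: z) by apply: (convex_setP _).1 => //; rewrite !ltW.
have := J_convex y z (t := a); rewrite a0 a1 => /(_ isT).
rewrite -(fineK (J_fin Us)) -(fineK (J_fin Uy)) -(fineK (J_fin Uz)).
by rewrite -!EFinM -EFinD lee_fin.
Qed.

Lemma dot_cone_convex q y z (a : R) : dual_cone C q -> U y -> U z -> 0 <= a <= 1 ->
  dot q (Theta (a *: y + (1 - a) *: z)) <= a * dot q (Theta y) + (1 - a) * dot q (Theta z).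
Proof.
move=> Cq Uy Uz a01; have [th /Cq] := cTheta Uy Uz a01.
move=> + E; have -> : Theta (a *: y + (1 - a) *: z) = - th + a *: Theta y + (1 - a) *: Theta z.
  by rewrite E addrAC !subrK.
by rewrite !dotE; lra.
Qed.

(** On the segment from x to y the convex terms are bounded by their chords, and only the quadratic
    is differentiated; its second-order part is left to [first_order_ge0]. *)
Lemma prox_le g q v alpha x : dual_cone C q ->
  argmin U (fun x => (dot g x)%:E + J x + (dot q (Theta x))%:E
    + ((2 * alpha)^-1 * enorm (x - v) ^+ 2)%:E)%E x ->
  U x /\ forall y, U y -> 0 <= dot (g + alpha^-1 *: (x - v)) (y - x) + fine (J y) - fine (J x)
     + dot q (Theta y - Theta x).
Proof.
move=> Cq [Ux xmin]; split => // y Uy.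
apply: (@first_order_ge0 _ _ ((2 * alpha)^-1 * dot (y - x) (y - x))) => t t0 t1.
have t01 : 0 <= t <= 1 by rewrite ltW.
have Us : U (t *: y + (1 - t) *: x) by exact: (convex_setP _).1.
have := xmin _ Us; rewrite -(fineK (J_fin Us)) -(fineK (J_fin Ux)) -!EFinD lee_fin.
have := fine_convex Uy Ux t01; have := dot_cone_convex Cq Uy Ux t01.
set Js := fine (J (t *: y + (1 - t) *: x)); set Ts := dot q (Theta (t *: y + _)).
have -> : t *: y + (1 - t) *: x - v = (x - v) + t *: (y - x).
  by apply/rowP => i; rewrite !mxE; ring.
rewrite !enorm_sqr (dotBr q) invfM.
rewrite !dotE !(dotC _ x) !(dotC _ v) => H1 H2 H3.
move: H1 H2 H3; lra.
Qed.

End prox.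

Lemma golden_ratio_le (R : realType) (eta : R) : (Num.sqrt 5 - 1) / 2 <= eta -> 0 < eta ->
  1 <= eta + eta ^+ 2.
Proof.
rewrite ler_pdivrMr// => H e0.
have s5 : Num.sqrt 5 ^+ 2 = 5 :> R by rewrite sqr_sqrtr.
have s0 : 0 <= Num.sqrt 5 :> R by rewrite sqrtr_ge0.
nra.
Qed.

(** Each projection is tested only at the other one. *)
Lemma proj_lipschitz (R : realType) (m : nat) (x y px py : 'rV[R]_m) :
  0 <= dot (px - x) (py - px) -> 0 <= dot (py - y) (px - py) ->
  enorm (px - py) <= enorm (x - y).
Proof.
move=> H1 H2.
have : enorm (px - py) ^+ 2 <= enorm (x - y) * enorm (px - py).
  apply: le_trans (dot_le _ _); rewrite enorm_sqr; move: H1 H2.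
  by rewrite !dotE !(dotC _ px) !(dotC _ py); lra.
have [->|nz] := eqVneq (enorm (px - py)) 0; first by rewrite enorm_ge0.
by rewrite expr2 ler_pM2r// lt_neqAle eq_sym nz enorm_ge0.
Qed.

(** * One-step decrease of the Lyapunov function *)

Section lyapunov.
Variables (R : realType) (n m : nat).
(** Here [a], [b], [c] stand for u k, u (k+1), u (k+2), primes advance the index of v, p and q from
    k, [Ga] and [Gb] are the values of G at [a] and [b], and [ta], [tb], [tc], [ts] those of Theta
    at [a], [b], [c], [us]. Keeping only the inequalities makes the step pure algebra. *)
Variables (a b c us v v' v'' Ga Gb : 'rV[R]_n) (p p' q q' ps ta tb tc ts : 'rV[R]_m).
Variables (jb jc js L tau eta alpha gamma : R).
Hypothesis L0 : 0 <= L.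
Hypothesis tau0 : 0 < tau.
Hypothesis eta0 : 0 < eta.
Hypothesis eta1 : eta < 1.
Hypothesis eta_golden : 1 <= eta + eta ^+ 2.
Hypothesis gamma0 : 0 < gamma.
Hypothesis gamma_tau : gamma * tau < 1.
Hypothesis alpha0 : 0 < alpha.
Hypothesis alpha_le : 2 * (gamma * tau ^+ 2 + L + tau) <= (alpha * eta)^-1.
Hypothesis vi_b : 0 <= dot (Ga + alpha^-1 *: (b - v)) (c - b) + jc - jb + dot q (tc - tb).
Hypothesis vi_c : 0 <= dot (Gb + alpha^-1 *: (c - v')) (us - c) + js - jc + dot q' (ts - tc).
Hypothesis minty : 0 <= dot Gb (b - us) + jb - js + dot ps (tb - ts).
Hypothesis comp : dot ts (q' - ps) <= 0.
Hypothesis p'_ps : 0 <= dot (p' - (p + gamma *: tb)) (ps - p').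
Hypothesis p'_q : 0 <= dot (p' - (p + gamma *: tb)) (q - p').
Hypothesis q_p' : 0 <= dot (q - (p + gamma *: ta)) (p' - q).
Hypothesis q'_q : 0 <= dot (q' - (p' + gamma *: tb)) (q - q').
Hypothesis lipG : enorm (Gb - Ga) <= L * enorm (b - a).
Hypothesis lipTa : enorm (tb - ta) <= tau * enorm (b - a).
Hypothesis lipTb : enorm (tc - tb) <= tau * enorm (c - b).
Hypothesis v'E : v' = (1 - eta) *: b + eta *: v.
Hypothesis v''E : v'' = (1 - eta) *: c + eta *: v'.

Let N k (x : 'rV[R]_k) := dot x x.

Let sqr_le (x y : R) : 0 <= x -> x <= y -> x ^+ 2 <= y ^+ 2.
Proof. by move=> x0 xy; rewrite ler_pXn2r// nnegrE (le_trans x0). Qed.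

Let NTa : N (tb - ta) <= tau ^+ 2 * N (b - a).
Proof. by rewrite /N -!enorm_sqr -exprMn sqr_le// enorm_ge0. Qed.

Let NTb : N (tc - tb) <= tau ^+ 2 * N (c - b).
Proof. by rewrite /N -!enorm_sqr -exprMn sqr_le// enorm_ge0. Qed.

Let cross_p : dot (p' - q) (tb - ta) <= gamma * tau ^+ 2 * N (b - a).
Proof.
have pq : enorm (p' - q) <= gamma * enorm (tb - ta).
  have := proj_lipschitz p'_q q_p'; rewrite opprD addrACA subrr add0r -scalerBr.
  by rewrite enormZ gtr0_norm.
apply: le_trans (dot_le _ _) _.
apply: (@le_trans _ _ (gamma * N (tb - ta))); last by rewrite -mulrA ler_wpM2l// ltW.
by rewrite /N -enorm_sqr expr2 mulrA ler_wpM2r// enorm_ge0.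
Qed.

(** The left side is 2 gamma times <ps - p', tb> + <p' - q, tb> + <q - q', tc>. Up to the errors tb
    - ta and tc - tb, the three terms are governed by [p'_ps], [q_p'] and [q'_q]. The three-point
    identities then telescope: the squares of p' - p and of p' - q cancel, and the square of q - q'
    absorbs the last error. *)
Let bracket : 2 * gamma * (dot ps tb - dot q' tc + dot q (tc - tb)) <=
  N (ps - p) - N (ps - p') - N (q' - p') + 2 * (gamma ^+ 2 * tau ^+ 2 * N (b - a))
  + gamma ^+ 2 * tau ^+ 2 * N (c - b).
Proof.
have Y1 : gamma * dot (p' - q) (tb - ta) <= gamma ^+ 2 * tau ^+ 2 * N (b - a).
  apply: le_trans (ler_wpM2l (ltW gamma0) cross_p) _.
  by rewrite le_eqVlt; apply/orP; left; apply/eqP; ring.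
have Y2 := dot_ge0 ((q - q') - gamma *: (tc - tb)).
have Y3 : gamma ^+ 2 * N (tc - tb) <= gamma ^+ 2 * tau ^+ 2 * N (c - b).
  by rewrite -mulrA ler_wpM2l// sqr_ge0.
have Y4 := dot_ge0 (q - p).
move: Y1 Y3 Y2 Y4 p'_ps q_p' q'_q.
set Nba := N (b - a); set Ncb := N (c - b); rewrite /N.
rewrite !dotE !(dotC _ ps) !(dotC _ p') !(dotC _ p) !(dotC _ q) !(dotC _ q') !(dotC _ ta)
  !(dotC _ tb) !(dotC _ tc).
lra.
Qed.

Let cross_G : 2 * dot (Gb - Ga) (b - c) <= L * N (b - a) + L * N (c - b).
Proof.
have H : dot (Gb - Ga) (b - c) <= L * enorm (b - a) * enorm (c - b).
  apply: le_trans (dot_le _ _) _; rewrite (enormBC b) ler_wpM2r ?enorm_ge0//.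
have := sqr_ge0 (enorm (b - a) - enorm (c - b)).
rewrite /N -!enorm_sqr => /(mulr_ge0 L0) H2; lra.
Qed.

(** Since b - v = (b - v') / eta, both products are centred at v'. As v'' is a convex combination of
    c and v', the square of us - c is expressed through that of us - v''. The coefficient left on
    the square of c - v' is nonpositive exactly when eta + eta^2 >= 1, whence the golden ratio. *)
Let prox_identity :
  2 * (dot (c - v') (us - c) + dot (b - v) (c - b)) =
  (1 - eta)^-1 * (N (us - v') - N (us - v'')) + (eta^-1 - 1 - eta) * N (c - v')
  - eta^-1 * N (b - v') - eta^-1 * N (c - b).
Proof.
have bv : b - v = eta^-1 *: (b - v').
  apply: (@scalerI _ _ eta); first by rewrite gt_eqF.
  rewrite scalerA mulfV ?gt_eqF// scale1r v'E.
  by apply/rowP => i; rewrite !mxE; ring.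
rewrite bv v''E /N !dotE !(dotC _ us) !(dotC _ c) !(dotC _ b) !(dotC _ v').
field; rewrite gt_eqF//= gt_eqF// subr_gt0//.
Qed.

Lemma lyapunov_step :
  (alpha * (1 - eta))^-1 * N (us - v'') + gamma^-1 * N (ps - p')
    + (L + 2 * gamma * tau ^+ 2) * N (c - b)
  + (tau * N (c - b) + (alpha * eta)^-1 * N (b - v') + gamma^-1 * N (q' - p')) <=
  (alpha * (1 - eta))^-1 * N (us - v') + gamma^-1 * N (ps - p)
    + (L + 2 * gamma * tau ^+ 2) * N (b - a).
Proof.
have Hb : 2 * (dot ps tb - dot q' tc + dot q (tc - tb)) <=
    gamma^-1 * (N (ps - p) - N (ps - p') - N (q' - p')) + 2 * (gamma * tau ^+ 2 * N (b - a))
    + gamma * tau ^+ 2 * N (c - b).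
  rewrite -(ler_pM2l gamma0); apply: le_trans (le_trans _ bracket) _.
    by rewrite le_eqVlt; apply/orP; left; apply/eqP; ring.
  by rewrite le_eqVlt; apply/orP; left; apply/eqP; field; rewrite gt_eqF.
have Hv : alpha^-1 * (2 * (dot (c - v') (us - c) + dot (b - v) (c - b))) <=
    (alpha * (1 - eta))^-1 * (N (us - v') - N (us - v'')) -
    (alpha * eta)^-1 * N (b - v') - (alpha * eta)^-1 * N (c - b).
  rewrite prox_identity.
  have : alpha^-1 * ((eta^-1 - 1 - eta) * N (c - v')) <= 0.
    rewrite pmulr_rle0 ?invr_gt0// mulr_le0_ge0 ?dot_ge0//.
    rewrite -(pmulr_rle0 _ eta0) !mulrBr mulfV ?gt_eqF// mulr1.
    by move: eta_golden; rewrite expr2; lra.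
  rewrite !invfM; lra.
have H0 : 0 <= 2 * dot (Gb - Ga) (b - c)
   + 2 * (dot ps tb - dot q' tc + dot q (tc - tb))
   + alpha^-1 * (2 * (dot (c - v') (us - c) + dot (b - v) (c - b))).
  move: vi_b vi_c minty comp; rewrite !dotE !(dotC _ ts); lra.
have gt : gamma * tau ^+ 2 <= tau by rewrite expr2 mulrA ler_piMl// ltW.
have Ncb : 0 <= N (c - b) by exact: dot_ge0.
(* Budget for the square of c - b: L from [cross_G], gamma tau^2 from [bracket], L + 2 gamma tau^2
   to rebuild the Lyapunov function, and tau kept as decrease. As gamma tau^2 <= tau, the bound on
   alpha covers the sum. *)
have : (2 * L + 3 * (gamma * tau ^+ 2) + tau) * N (c - b) <= (alpha * eta)^-1 * N (c - b).
  by rewrite ler_wpM2r//; move: alpha_le; lra.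
move: H0 Hb Hv cross_G; lra.
Qed.

End lyapunov.

Lemma enorm_row_mx (R : realType) (n m : nat) (x : 'rV[R]_n) (y : 'rV[R]_m) :
  enorm (row_mx x y) <= enorm x + enorm y.
Proof.
rewrite -(@ler_pXn2r _ 2) ?nnegrE ?addr_ge0 ?enorm_ge0// sqrrD !enorm_sqr.
have -> : dot (row_mx x y) (row_mx x y) = dot x x + dot y y.
  rewrite /dot big_split_ord/=; congr (_ + _); apply: eq_bigr => i _.
    by rewrite row_mxEl.
  by rewrite row_mxEr.
have : 0 <= enorm x * enorm y *+ 2 by rewrite mulrn_wge0// mulr_ge0 ?enorm_ge0.
lra.
Qed.

(** * Summable residuals and the rate for the iterates *)

Section alavi.
Variables (R : realType) (n m : nat) (G : 'rV[R]_n -> 'rV[R]_n).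
Variables (J : 'rV[R]_n -> \bar R) (Theta : 'rV[R]_n -> 'rV[R]_m).
Variables (U O : set 'rV[R]_n) (C : set 'rV[R]_m) (L tau eta alpha gamma : R).
Variables (v u : nat -> 'rV[R]_n) (p q : nat -> 'rV[R]_m).
Hypothesis U_convex : convex_set U.
Hypothesis J_fin : forall x, U x -> J x \is a fin_num.
Hypothesis J_cont : forall x, U x -> {for x, continuous J}.
Hypothesis J_proper : proper J.
Hypothesis J_convex : econvex J.
Hypothesis L0 : 0 <= L.
Hypothesis lipG : elipschitz L U G.
Hypothesis cTheta : cone_convex C U Theta.
Hypothesis tau0 : 0 < tau.
Hypothesis oO : open O.
Hypothesis UO : U `<=` O.
Hypothesis lipT : elipschitz tau O Theta.
Hypothesis eta_ge : (Num.sqrt 5 - 1) / 2 <= eta.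
Hypothesis eta1 : eta < 1.
Hypothesis gamma0 : 0 < gamma.
Hypothesis gamma_lt : gamma < 1 / tau.
Hypothesis alpha0 : 0 < alpha.
Hypothesis alpha_le : alpha <= 1 / (2 * (gamma * tau ^+ 2 + L + tau) * eta).
Hypothesis H_alavi : ALAVI G J Theta U C eta alpha gamma v u p q.
Variables (us : 'rV[R]_n) (ps : 'rV[R]_m).
Hypothesis H_mvis : MVIS G J Theta U C (us, ps).

Let eta0 : 0 < eta.
Proof.
apply: lt_le_trans eta_ge; rewrite divr_gt0// subr_gt0.
by rewrite -[ltLHS]sqrtr1 ltr_sqrt// ltr1n.
Qed.

Let gamma_tau : gamma * tau < 1.
Proof. by rewrite -ltr_pdivlMr. Qed.

Let alpha_eta : 2 * (gamma * tau ^+ 2 + L + tau) <= (alpha * eta)^-1.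
Proof.
have X0 : 0 < 2 * (gamma * tau ^+ 2 + L + tau).
  have : 0 < gamma * tau ^+ 2 by rewrite mulr_gt0// exprn_gt0.
  move: L0 tau0; lra.
have ae0 : 0 < alpha * eta by rewrite mulr_gt0.
move: alpha_le; rewrite ler_pdivlMr; last exact: mulr_gt0.
move=> H.
by rewrite -[leRHS]mul1r ler_pdivlMr// mulrC -mulrA (mulrC eta).
Qed.

Let Uu k : U (u k).
Proof. by case: k => [|k]; [exact: H_alavi.1|have [_ []] := H_alavi.2 k]. Qed.

Let q_vi k : dual_cone C (q k) /\ forall r, dual_cone C r ->
  0 <= dot (q k - (p k + gamma *: Theta (u k))) (r - q k).
Proof. by have [H _ _ _] := H_alavi.2 k; exact: (proj_le (@dual_cone_convex _ _ _) H). Qed.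

Let p_vi k : dual_cone C (p k.+1) /\ forall r, dual_cone C r ->
  0 <= dot (p k.+1 - (p k + gamma *: Theta (u k.+1))) (r - p k.+1).
Proof. by have [_ _ H _] := H_alavi.2 k; exact: (proj_le (@dual_cone_convex _ _ _) H). Qed.

Let u_vi k y : U y -> 0 <= dot (G (u k) + alpha^-1 *: (u k.+1 - v k)) (y - u k.+1)
  + fine (J y) - fine (J (u k.+1)) + dot (q k) (Theta y - Theta (u k.+1)).
Proof.
have [_ H _ _] := H_alavi.2 k.
by have [_] := prox_le U_convex J_fin J_convex cTheta (q_vi k).1 H; exact.
Qed.

Let vE k : v k.+1 = (1 - eta) *: u k.+1 + eta *: v k.
Proof. by have [] := H_alavi.2 k. Qed.

Let Us : U us. Proof. by have [] := H_mvis. Qed.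

Let lipTU x y : U x -> U y -> enorm (Theta x - Theta y) <= tau * enorm (x - y).
Proof. by move=> /UO Ox /UO Oy; exact: lipT. Qed.

(** The index of v is one ahead of that of p: a step uses the variational inequalities centred at v
    k and v (k+1), and [prox_identity] eliminates the former. *)
Let E k := (alpha * (1 - eta))^-1 * dot (us - v k.+1) (us - v k.+1)
  + gamma^-1 * dot (ps - p k) (ps - p k)
  + (L + 2 * gamma * tau ^+ 2) * dot (u k.+1 - u k) (u k.+1 - u k).

Let D k := tau * dot (u k.+2 - u k.+1) (u k.+2 - u k.+1)
  + (alpha * eta)^-1 * dot (u k.+1 - v k.+1) (u k.+1 - v k.+1)
  + gamma^-1 * dot (q k.+1 - p k.+1) (q k.+1 - p k.+1).

Let ED k : E k.+1 + D k <= E k.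
Proof.
have [_ dps minty comp] := H_mvis.
apply: (@lyapunov_step _ _ _ (u k) (u k.+1) (u k.+2) us (v k) (v k.+1) (v k.+2)
  (G (u k)) (G (u k.+1)) (p k) (p k.+1) (q k) (q k.+1) ps
  (Theta (u k)) (Theta (u k.+1)) (Theta (u k.+2)) (Theta us)
  (fine (J (u k.+1))) (fine (J (u k.+2))) (fine (J us))) => //.
- exact: golden_ratio_le.
- exact: u_vi.
- exact: u_vi.
- have := minty _ (Uu k.+1).
  by rewrite -(fineK (J_fin (Uu k.+1))) -(fineK (J_fin Us)) -EFinN -!EFinD lee_fin.
- by apply: comp; exact: (q_vi k.+1).1.
- exact: (p_vi k).2.
- by apply: (p_vi k).2; exact: (q_vi k).1.
- by apply: (q_vi k).2; exact: (p_vi k).1.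
- by apply: (q_vi k.+1).2; exact: (q_vi k).1.
- exact: lipG.
- exact: lipTU.
- exact: lipTU.
Qed.

Let E_ge0 k : 0 <= E k.
Proof.
have a1 : 0 <= (alpha * (1 - eta))^-1.
  by rewrite invr_ge0 mulr_ge0 ?subr_ge0// ltW.
have a2 : 0 <= L + 2 * gamma * tau ^+ 2.
  by rewrite addr_ge0// !mulr_ge0 ?sqr_ge0// ltW.
have a3 : 0 <= gamma^-1 by rewrite invr_ge0 ltW.
by rewrite /E !addr_ge0// mulr_ge0// dot_ge0.
Qed.

Let sum_D N : \sum_(k < N) D k <= E 0.
Proof.
suff : \sum_(k < N) D k + E N <= E 0 by have := E_ge0 N; lra.
elim: N => [|N IH]; first by rewrite big_ord0 add0r.
by rewrite big_ord_recr/=; have := ED N; lra.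
Qed.

Let s k := enorm (u k.+2 - u k.+1) + enorm (u k.+1 - v k.+1) + enorm (q k.+1 - p k.+1).

Let s_ge0 k : 0 <= s k.
Proof. by rewrite !addr_ge0 ?enorm_ge0. Qed.

Let sum_s : exists M, forall N, \sum_(k < N) s k ^+ 2 <= M.
Proof.
(* The smallest weight in [D]; the factor 3 comes from (x + y + z)^2 <= 3 (x^2 + y^2 + z^2). *)
pose kap := Num.min tau (Num.min (alpha * eta)^-1 gamma^-1).
have kap0 : 0 < kap by rewrite !lt_min tau0 !invr_gt0 mulr_gt0//= gamma0.
exists (3 / kap * E 0) => N.
apply: (@le_trans _ _ (3 / kap * \sum_(k < N) D k)); last first.
  by rewrite ler_wpM2l ?sum_D// divr_ge0// ltW.
rewrite mulr_sumr; apply: ler_sum => k _.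
rewrite mulrAC ler_pdivlMr// /s /D -!enorm_sqr.
set x := enorm (u k.+2 - u k.+1); set y := enorm (u k.+1 - _); set z := enorm (q _ - _).
have H1 : kap * x ^+ 2 <= tau * x ^+ 2 by rewrite ler_wpM2r ?sqr_ge0// ge_min lexx.
have H2 : kap * y ^+ 2 <= (alpha * eta)^-1 * y ^+ 2.
  by rewrite ler_wpM2r ?sqr_ge0// !ge_min lexx !orbT.
have H3 : kap * z ^+ 2 <= gamma^-1 * z ^+ 2.
  by rewrite ler_wpM2r ?sqr_ge0// !ge_min lexx !orbT.
have H4 := mulr_ge0 (ltW kap0) (sqr_ge0 (x - y)).
have H5 := mulr_ge0 (ltW kap0) (sqr_ge0 (x - z)).
have H6 := mulr_ge0 (ltW kap0) (sqr_ge0 (y - z)).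
lra.
Qed.

Let pq_le k : enorm (p k.+2 - q k.+1) <= gamma * tau * enorm (u k.+2 - u k.+1).
Proof.
have := proj_lipschitz ((p_vi k.+1).2 _ (q_vi k.+1).1) ((q_vi k.+1).2 _ (p_vi k.+1).1).
rewrite opprD addrACA subrr add0r -scalerBr enormZ gtr0_norm// => /le_trans; apply.
by rewrite -mulrA ler_pM2l// lipTU.
Qed.

Let dp_le k : enorm (p k.+1 - p k.+2) <= s k.
Proof.
have -> : p k.+1 - p k.+2 = - (q k.+1 - p k.+1) - (p k.+2 - q k.+1).
  by rewrite !opprB addrA subrK.
apply: le_trans (enormB _ _) _; rewrite enormN.
have := pq_le k; have := enorm_ge0 (u k.+1 - v k.+1).
have : gamma * tau * enorm (u k.+2 - u k.+1) <= enorm (u k.+2 - u k.+1).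
  by rewrite ler_piMl ?enorm_ge0// ltW.
rewrite /s; lra.
Qed.

Let uv_le k : enorm (u k.+2 - v k.+1) <= s k.
Proof.
rewrite -(subrKA (u k.+1)); apply: le_trans (enormD _ _) _.
by rewrite /s lerDl enorm_ge0.
Qed.

Let iterate_le k : enorm (iterate v u p k.+1 - iterate v u p k.+2) <= 3 * s k.
Proof.
rewrite /iterate !opp_row_mx !add_row_mx.
apply: le_trans (enorm_row_mx _ _) _.
apply: le_trans (lerD (lexx _) (enorm_row_mx _ _)) _.
have Hv : enorm (v k.+1 - v k.+2) <= s k.
  have -> : v k.+1 - v k.+2 = - (1 - eta) *: (u k.+2 - v k.+1).
    by rewrite (vE k.+1); apply/rowP => i; rewrite !mxE; ring.
  rewrite enormZ normrN ger0_norm ?subr_ge0 ?(ltW eta1)//.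
  apply: le_trans (uv_le k); rewrite ler_piMl ?enorm_ge0//.
  by rewrite gerBl ltW.
have Hu : enorm (u k.+1 - u k.+2) <= s k.
  by rewrite enormBC /s -addrA lerDl addr_ge0 ?enorm_ge0.
have := dp_le k; lra.
Qed.

Let kkt_le k : (dist0 (KKT G J Theta U C (u k.+2) (p k.+2)) <=
  ((L + tau + alpha^-1 + gamma^-1) * s k)%:E)%E.
Proof.
apply/lee_addgt0Pr => e e0.
have [xi [A [nu [sxi cA nnu small]]]] := kkt_approx U_convex J_fin J_cont J_proper J_convex
  (ltW tau0) oO lipT UO (Uu k.+2) (@u_vi k.+1) e0.
(* The projection inequality makes this a normal vector to the dual cone. Dividing by gamma cancels
   Theta in the second block, leaving (p (k+1) - p (k+2)) / gamma. *)
pose mu := - gamma^-1 *: (p k.+2 - (p k.+1 + gamma *: Theta (u k.+2))).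
pose h := row_mx (G (u k.+2) + xi + p k.+2 *m A + nu) (- Theta (u k.+2) + mu).
apply: (@le_trans _ _ (enorm h)%:E).
  apply: ereal_inf_lbound; exists h => //; exists xi, A, nu, mu; split => //.
  move=> r Cr; rewrite /mu dotZl mulNr oppr_le0 mulr_ge0 ?invr_ge0 ?(ltW gamma0)//.
  exact: (p_vi k.+1).2.
rewrite -EFinD lee_fin; apply: le_trans (enorm_row_mx _ _) _.
have -> : - Theta (u k.+2) + mu = gamma^-1 *: (p k.+1 - p k.+2).
  apply/rowP => i; rewrite !mxE; field; rewrite gt_eqF//.
(* The optimality condition holds with G (u (k+1)), q (k+1) and the proximal term. The same xi, A
   and nu are kept, and each replacement costs a multiple of [s k]. *)
have -> : G (u k.+2) + xi + p k.+2 *m A + nu =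
    (G (u k.+1) + alpha^-1 *: (u k.+2 - v k.+1) + xi + q k.+1 *m A + nu)
    + (G (u k.+2) - G (u k.+1)) + (p k.+2 - q k.+1) *m A - alpha^-1 *: (u k.+2 - v k.+1).
  by rewrite mulmxBl; apply/rowP => i; rewrite ![in LHS]mxE ![in RHS]mxE; ring.
rewrite [enorm (gamma^-1 *: _)]enormZ gtr0_norm ?invr_gt0//.
have H1 : enorm (alpha^-1 *: (u k.+2 - v k.+1)) <= alpha^-1 * s k.
  by rewrite enormZ gtr0_norm ?invr_gt0// ler_pM2l ?invr_gt0.
have us_le : enorm (u k.+2 - u k.+1) <= s k.
  by rewrite /s -addrA lerDl addr_ge0 ?enorm_ge0.
have H2 : enorm (G (u k.+2) - G (u k.+1)) <= L * s k.
  by apply: le_trans (lipG (Uu _) (Uu _)) _; rewrite ler_wpM2l.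
have H3 : enorm ((p k.+2 - q k.+1) *m A) <= tau * s k.
  apply: le_trans (clarke_jacobian_enorm (ltW tau0) oO lipT (UO (Uu k.+2)) _ cA) _.
  rewrite ler_pM2l//; apply: le_trans (pq_le k) _; apply: le_trans us_le.
  by rewrite ler_piMl ?enorm_ge0// ltW.
have H4 : gamma^-1 * enorm (p k.+1 - p k.+2) <= gamma^-1 * s k.
  by rewrite ler_pM2l ?invr_gt0.
apply: le_trans (lerD (enormB _ _) (lexx _)) _.
apply: le_trans (lerD (lerD (enormD _ _) (lexx _)) (lexx _)) _.
apply: le_trans (lerD (lerD (lerD (enormD _ _) (lexx _)) (lexx _)) (lexx _)) _.
lra.
Qed.

(** The estimates start at index 2, so the value of [k.-1] at k = 0 does not affect them. *)
Lemma alavi_rate :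
  limn_einf (fun k : nat =>
    (Num.sqrt k%:R * enorm (iterate v u p k.-1 - iterate v u p k))%:E) = 0%E /\
  limn_einf (fun k : nat =>
    (Num.sqrt k%:R)%:E * dist0 (KKT G J Theta U C (u k) (p k)))%E = 0%E.
Proof.
have [M sM] := sum_s; split.
- apply: (@limn_einf_sqrt _ _ s 3 M) => // k.
    by rewrite lee_fin mulr_ge0 ?sqrtr_ge0 ?enorm_ge0.
  by rewrite lee_fin ler_wpM2l ?sqrtr_ge0 ?iterate_le.
- apply: (@limn_einf_sqrt _ _ s (L + tau + alpha^-1 + gamma^-1) M) => //.
  + have a0 : 0 < alpha^-1 by rewrite invr_gt0.
    have g0 : 0 < gamma^-1 by rewrite invr_gt0.
    move: L0 tau0; lra.
  + move=> k; rewrite mule_ge0 ?lee_fin ?sqrtr_ge0//.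
    by apply: le_ereal_inf_tmp => _ [h _ <-]; rewrite lee_fin enorm_ge0.
  + by move=> k; rewrite EFinM lee_wpmul2l ?lee_fin ?sqrtr_ge0// kkt_le.
Qed.

End alavi.

Theorem theorem2 (R : realType) (n m : nat)
    (G : 'rV[R]_n -> 'rV[R]_n) (J : 'rV[R]_n -> \bar R)
    (Theta : 'rV[R]_n -> 'rV[R]_m) (U : set 'rV[R]_n) (C : set 'rV[R]_m)
    (L tau eta alpha gamma : R)
    (v u : nat -> 'rV[R]_n) (p q : nat -> 'rV[R]_m)
    (G_cont : continuous G)
    (U_closed : closed U) (U_convex : convex_set U)
    (J_fin : forall x, U x -> J x \is a fin_num)
    (J_cont : forall x, U x -> {for x, continuous J})
    (Theta_cont : continuous Theta)
    (C_neq0 : C !=set0) (C_closed : closed C) (C_convex : convex_set C)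
    (C_cone : cone C)
    (A1 : VIP G J Theta U C !=set0)
    (A2 : 0 <= L /\ elipschitz L U G)
    (A3 : [/\ proper J, econvex J & lower_semicontinuous J])
    (A4 : cone_convex C U Theta)
    (A5 : 0 < tau /\
      exists O : set 'rV[R]_n, [/\ open O, U `<=` O & elipschitz tau O Theta])
    (A6 : (interior C !=set0 ->
            Theta @` U `&` opp_set (interior C) !=set0) /\
          (C = [set 0] -> interior (Theta @` U) 0))
    (coherence : MVIS G J Theta U C !=set0)
    (eta_bounds : (Num.sqrt 5 - 1) / 2 <= eta < 1)
    (gamma_bounds : 0 < gamma < 1 / tau)
    (alpha_bounds :
      0 < alpha <= 1 / (2 * (gamma * tau ^+ 2 + L + tau) * eta))
    (alavi : ALAVI G J Theta U C eta alpha gamma v u p q) :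
  limn_einf (fun k : nat =>
    (Num.sqrt k%:R *
       enorm (iterate v u p k.-1 - iterate v u p k))%:E) = 0%E
  /\
  limn_einf (fun k : nat =>
    (Num.sqrt k%:R)%:E * dist0 (KKT G J Theta U C (u k) (p k)))%E = 0%E.
Proof.
have [L0 lipG] := A2; have [J_proper J_convex _] := A3.
have [tau0 [V [oV UV lipT]]] := A5.
have /andP[eta_ge eta1] := eta_bounds.
have /andP[gamma0 gamma_lt] := gamma_bounds.
have /andP[alpha0 alpha_le] := alpha_bounds.
have [[us ps] mvis] := coherence.
exact: (@alavi_rate R n m G J Theta U V C L tau eta alpha gamma v u p q U_convex
  J_fin J_cont J_proper J_convex L0 lipG A4 tau0 oV UV lipT eta_ge eta1 gamma0
  gamma_lt alpha0 alpha_le alavi us ps mvis).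
Qed.
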